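(* Let $\mathbb X=(X,\mathcal B,\mu,T)$ be an ergodic measure preserving transformation. Then either 1. $\mathbb X$ has an odometer factor, or 2. there is an odometer $\mathfrak O$ such that the product system $\mathbb X\times\mathfrak O$ is ergodic (and $\mathbb X\times\mathfrak O$ has finite entropy if $\mathbb X$ does).
   Context: Measure preserving transformations are invertible measure preserving transformations of standard probability spaces. Given a sequence $\langle k_n:n\in\mathbb N\rangle$ of integers $k_n\ge 2$, the associated odometer $\mathfrak O$ is the compact space $O=\prod_n\mathbb Z/k_n\mathbb Z$ with the homeomorphism that adds $(1,0,0,\dots)$ with carrying to the right, equipped with the product of the uniform probability measures on the coordinates (Haar measure). $\mathbb X$ has an odometer factor if for some such sequence the odometer is a measure theoretic factor of $\mathbb X$. The product system carries the product measure and the product transformation. *)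

(* Defs.v *)
From HB Require Import structures.
From mathcomp Require Import all_boot all_order all_algebra.
From mathcomp Require Import all_classical all_reals all_analysis.

Set Implicit Arguments.
Unset Strict Implicit.
Unset Printing Implicit Defensive.

Import Order.TTheory GRing.Theory Num.Theory.

Local Open Scope classical_set_scope.
Local Open Scope ring_scope.

Definition separable_space (P : topologicalType) : Prop :=
  exists D : set P, countable D /\ dense D.

Definition borel {P : topologicalType} : set (set P) := <<s @open P >>.

(* Isomorphism modulo null sets with a Polish space carrying a Borel
   probability measure.  The sigma-algebra of X may be standard Borel (take
   X0 = setT and E = f @` A) or the completion of such a one: the last clause
   asks for the image of a measurable set to be Borel up to a null set only. *)
Definition standard_probability_space d (X : measurableType d) (R : realType)
    (mu : probability X R) : Prop :=
  exists (P : completePseudoMetricType R) (X0 : set X) (f : X -> P),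
  [/\ hausdorff_space P /\ separable_space P,
      measurable X0 /\ mu X0 = 1%E,
      set_bij X0 [set: P] f,
      forall E, borel E -> measurable (X0 `&` f @^-1` E) &
      forall A, measurable A -> A `<=` X0 ->
        exists E, [/\ borel E, E `<=` f @` A & mu (A `\` f @^-1` E) = 0%E]].

Section systems.
Context d1 d2 (X : measurableType d1) (Y : measurableType d2) (R : realType).
Implicit Types (mu : {measure set X -> \bar R}) (nu : {measure set Y -> \bar R}).

Definition measure_preserving mu nu (f : X -> Y) : Prop :=
  measurable_fun setT f /\
  forall B, measurable B -> mu (f @^-1` B) = nu B.

Definition is_factor mu (T : X -> X) nu (S : Y -> Y) : Prop :=
  exists p : X -> Y, measure_preserving mu nu p /\
    {ae mu, forall x, p (T x) = S (p x)}.

Definition product_map (T : X -> X) (S : Y -> Y) (z : X * Y) : X * Y :=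
  (T z.1, S z.2).

End systems.

Section transformation.
Context d (X : measurableType d) (R : realType).
Variables (mu : {measure set X -> \bar R}) (T : X -> X).

Definition invertible_measure_preserving : Prop :=
  measure_preserving mu mu T /\
  exists S : X -> X, [/\ cancel T S, cancel S T & measurable_fun setT S].

Definition ergodic : Prop :=
  invertible_measure_preserving /\
  forall A, measurable A -> T @^-1` A = A -> mu A = 0%E \/ mu A = 1%E.

(* A finite partition is given by its labelling function. *)
Definition measurable_partition (I : finType) (xi : X -> I) : Prop :=
  forall i, measurable (xi @^-1` [set i]).

Definition partition_entropy (I : finType) (xi : X -> I) : R :=
  - \sum_(i : I) fine (mu (xi @^-1` [set i])) * ln (fine (mu (xi @^-1` [set i]))).

(* Labelling function of the join of the T^-j xi for j < m. *)
Definition itinerary (I : finType) (xi : X -> I) (m : nat) (x : X) :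
    {ffun 'I_m -> I} :=
  [ffun j : 'I_m => xi (iter j T x)].

Definition partition_entropy_rate (I : finType) (xi : X -> I) : \bar R :=
  limn (fun m => (partition_entropy (itinerary xi m) / m%:R)%:E).

(* Kolmogorov-Sinai entropy *)
Definition entropy : \bar R :=
  ereal_sup [set h | exists n (xi : X -> 'I_n),
    measurable_partition xi /\ h = partition_entropy_rate xi].

End transformation.

(* 'Z_n is Z/nZ only for n >= 2: see is_odometer. *)
Definition odometer_points (k : nat -> nat) : Type := forall n, 'Z_(k n).

HB.instance Definition _ (k : nat -> nat) :=
  Choice.copy (odometer_points k) (forall n, 'Z_(k n)).
HB.instance Definition _ (k : nat -> nat) :=
  isPointed.Build (odometer_points k) (fun=> 0).

(* These sets form a countable subbasis of the product topology, so that the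
   sigma-algebra they generate is the Borel one. *)
Definition coordinate_sets (k : nat -> nat) : set (set (odometer_points k)) :=
  [set A | exists n (a : 'Z_(k n)), A = [set x | x n = a]].

Definition odometer (k : nat -> nat) :=
  g_sigma_algebraType (@coordinate_sets k).

(* Adds (1, 0, 0, ...): coordinate n receives a carry iff every coordinate
   before it has its last value -1. *)
Definition odometer_map (k : nat -> nat) (x : odometer k) : odometer k :=
  fun n => if [forall j : 'I_n, x j == -1] then x n + 1 else x n.

(* nu is the product of the uniform probability measures on the coordinates;
   being determined on the cylinders, it is unique. *)
Definition is_odometer (k : nat -> nat) (R : realType)
    (nu : probability (odometer k) R) : Prop :=
  (forall n, 2 <= k n)%N /\
  forall (n : nat) (A : forall i, {set 'Z_(k i)}),
    nu [set x | forall i, (i < n)%N -> x i \in A i] =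
    (\prod_(i < n) (#|A i|%:R / (k i)%:R))%:E.

Definition has_odometer_factor d (X : measurableType d) (R : realType)
    (mu : probability X R) (T : X -> X) : Prop :=
  exists (k : nat -> nat) (nu : probability (odometer k) R),
    is_odometer nu /\ is_factor mu T nu (@odometer_map k).

(* Main.v *)
(* Say that p is a period if T has the cyclic rotation of order p as a factor.

   If every prime is a period, then so are the products P_n of the first n terms
   of a sequence of distinct primes, by the Chinese remainder theorem.  The
   resulting maps to Z/P_n are compatible and define a factor map to the
   odometer, because a measurable map c to Z/P_n with c o T = c + 1 is uniformly
   distributed.

   Otherwise some prime p is not a period, and every power T^(p^n) is ergodic.
   Take the p-adic odometer O, with Haar measure nu. For an invariant set A of
   X x O and a cylinder C of length n, the measure of the part of A_x in C is
   invariant under T^(p^n), hence constant, and the constant depends on n only.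
   So almost every section A_x is independent of all cylinders, hence of
   itself: nu (A_x) is 0 or 1, and it is almost everywhere constant. As for the
   entropy, a finite partition of X x O is approximated by a partition
   depending on x and on finitely many digits of y only. The error costs at
   most 2 per unit of time, the digits a bounded amount altogether, so that
   h (T x S) <= h (T) + 2. *)

Require Import Defs.
From mathcomp Require Import all_boot all_order all_algebra.
From mathcomp Require Import all_classical all_reals all_analysis.
From mathcomp Require Import measurable_realfun.
From mathcomp Require Import zify ring lra.

Set Implicit Arguments.
Unset Strict Implicit.
Unset Printing Implicit Defensive.

Import Order.TTheory GRing.Theory Num.Theory.
Import numFieldNormedType.Exports.

Local Open Scope classical_set_scope.
Local Open Scope ring_scope.

(** * Entropy of finite partitions *)

Section fiber_measurable.
Context d (X : measurableType d).

(** Labels live in bare types without a sigma-algebra, so measurability is asked of fibers; over a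
    finite type this is [measurable_partition]. *)
Definition fiber_measurable (I : Type) (f : X -> I) : Prop :=
  forall i, measurable (f @^-1` [set i]).

Lemma fiber_measurable_preimage (I : countType) (f : X -> I) (A : set I) :
  fiber_measurable f -> measurable (f @^-1` A).
Proof.
move=> mf; have -> : f @^-1` A =
    \bigcup_n (f @^-1` (A `&` [set i | choice.pickle i = n])).
  by rewrite -preimage_bigcup -setI_bigcupr; congr preimage; apply/seteqP; split
    => [i Ai|i []//]; split => //; exists (choice.pickle i).
apply: bigcupT_measurable => n.
have [[i [Ai <-]]|none] := pselect (exists i, A i /\ choice.pickle i = n).
  rewrite (_ : _ `&` _ = [set i]); first exact: mf.
  apply/seteqP; split => [j [_] /(pcan_inj choice.pickleK)//|j ->]; by split.
rewrite (_ : _ `&` _ = set0) ?preimage_set0//.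
by apply/seteqP; split => // i [Ai ni]; apply: none; exists i.
Qed.

Lemma fiber_measurable_comp (I : countType) J (f : X -> I) (h : I -> J) :
  fiber_measurable f -> fiber_measurable (h \o f).
Proof. by move=> mf j; rewrite comp_preimage; exact: fiber_measurable_preimage. Qed.

Lemma fiber_measurable_pair I J (f : X -> I) (g : X -> J) :
  fiber_measurable f -> fiber_measurable g ->
  fiber_measurable (fun x => (f x, g x)).
Proof.
move=> mf mg [i j]; rewrite (_ : _ @^-1` _ = f @^-1` [set i] `&` g @^-1` [set j]).
  exact: measurableI.
by apply/seteqP; split => x /=; [case=> -> ->|case=> /= -> ->].
Qed.

Lemma fiber_measurable_ffun (J : finType) I (f : J -> X -> I) :
  (forall j, fiber_measurable (f j)) ->
  fiber_measurable (fun x => [ffun j => f j x]).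
Proof.
move=> mf w; rewrite (_ : _ @^-1` _ = \bigcap_(j in [set: J]) f j @^-1` [set w j]).
  by apply: fin_bigcap_measurable => [|j _]; [exact: finite_finset|exact: mf].
apply/seteqP; split => x /=; first by move=> <- j _; rewrite /= ffunE.
by move=> fx; apply/ffunP => j; rewrite ffunE; exact: fx.
Qed.

Lemma fiber_measurable_set (A : set X) :
  measurable A -> fiber_measurable (fun x => `[< A x >]).
Proof.
move=> mA [].
  by rewrite (_ : _ @^-1` _ = A)//; apply/seteqP; split => x /= /asboolP.
rewrite (_ : _ @^-1` _ = ~` A); first exact: measurableC.
by apply/seteqP; split => x /=; [move/negbT/asboolPn|move/asboolPn/negbTE].
Qed.

End fiber_measurable.

Lemma fiber_measurable_precomp d d' (X : measurableType d)
    (Y : measurableType d') I (T : X -> Y) (f : Y -> I) :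
  measurable_fun setT T -> fiber_measurable f -> fiber_measurable (f \o T).
Proof. by move=> mT mf i; rewrite comp_preimage -[_ @^-1` _]setTI; exact: mT. Qed.

Lemma measurable_fun_iter d (X : measurableType d) (T : X -> X) n :
  measurable_fun setT T -> measurable_fun setT (iter n T).
Proof.
move=> mT; elim: n => [|n IH]; first exact: measurable_id.
exact: (measurableT_comp mT).
Qed.

Lemma measure_preserving_iter d (X : measurableType d) (R : realType)
    (mu : {measure set X -> \bar R}) (T : X -> X) n :
  measure_preserving mu mu T -> measure_preserving mu mu (iter n T).
Proof.
move=> [mT T_mu]; split; first exact: measurable_fun_iter.
elim: n => [//|n IH] B mB.
rewrite (_ : _ @^-1` _ = iter n T @^-1` (T @^-1` B))// IH ?T_mu//.
by rewrite -[_ @^-1` _]setTI; exact: mT.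
Qed.

(** * Elementary estimates for [p ln p] *)

Section entropy_terms.
Variable R : realType.
Implicit Types p q r s : R.

(** This is [ln t <= t - 1] at [t = s / r], scaled by [r]. The implication between the signs keeps
    [ln 0], which is 0 by convention, out of the case [0 < r]. *)
Lemma mul_ln_ratio_le r s : 0 <= r -> 0 <= s -> (0 < r -> 0 < s) ->
  r * (ln s - ln r) <= s - r.
Proof.
move=> + s0; rewrite le_eqVlt => /predU1P[<- _|r0 /(_ r0) {}s0].
  by rewrite mul0r subr0.
rewrite -ln_div ?posrE// -[X in _ <= X - _](mulfVK (lt0r_neq0 r0) s).
rewrite -[X in _ <= _ - X]mul1r -mulrBl mulrC ler_pM2r//.
have -> : s / r = 1 + (s / r - 1) by rewrite addrC subrK.
by rewrite [X in _ <= X - _]addrC addrK le_ln1Dx// ltrBrDl addrN divr_gt0.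
Qed.

Lemma mul_ln_prod_le p q r : 0 <= r -> r <= p -> r <= q ->
  r * (ln p + ln q - ln r) <= p * q - r.
Proof.
move=> r0 rp rq; have p0 := le_trans r0 rp; have q0 := le_trans r0 rq.
have [->|rneq0] := eqVneq r 0; first by rewrite mul0r subr0 mulr_ge0.
have {}r0 : 0 < r by rewrite lt_neqAle eq_sym rneq0.
have {}p0 := lt_le_trans r0 rp; have {}q0 := lt_le_trans r0 rq.
rewrite -lnM ?posrE//.
by apply: mul_ln_ratio_le; rewrite ?ltW ?mulr_gt0.
Qed.

Lemma neg_mul_ln_le1 p : 0 <= p -> - (p * ln p) <= 1.
Proof.
move=> p0; have := mul_ln_ratio_le p0 ler01 (fun=> ltr01).
by rewrite ln1 sub0r mulrN; lra.
Qed.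

(** With [s] the square root of [p], [- p ln p] is [2 s] times [- s ln s], and the latter is at most
    1. *)
Lemma neg_mul_ln_le_sqrt p e : 0 <= p -> p <= e ^+ 2 -> 0 <= e ->
  - (p * ln p) <= 2 * e.
Proof.
rewrite le_eqVlt => /predU1P[<-|p0] pe e0; first by rewrite mul0r oppr0 mulr_ge0.
set s := Num.sqrt p; have s0 : 0 < s by rewrite sqrtr_gt0.
have ps : p = s ^+ 2 by rewrite sqr_sqrtr// ltW.
have se : s <= e by rewrite -ler_sqr ?nnegrE ?(ltW s0)// -ps.
have := mul_ln_ratio_le (ltW s0) ler01 (fun=> ltr01).
rewrite ps lnXn// ln1 sub0r => h.
rewrite -mulr_natl expr2.
by nra.
Qed.

End entropy_terms.

Section label_measure.
Context d (X : measurableType d) (R : realType).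
Variable m : {measure set X -> \bar R}.

(** Stated for any measure, since it is also applied to restrictions of a probability to a set. *)
Lemma measure_preimage_sum (I : finType) (f : X -> I) (P : pred I) :
  fiber_measurable f ->
  m (f @^-1` [set i | P i]) = (\sum_(i | P i) m (f @^-1` [set i]))%E.
Proof.
move=> mf; rewrite (_ : _ @^-1` _ = \bigcup_(i in [set` enum P]) f @^-1` [set i]).
  rewrite measure_fin_bigcup//.
  - by rewrite -fsbig_seq ?enum_uniq// big_enum.
  - by move=> i j _ _ [x [<- <-]].
apply/seteqP; split => x /=.
  by move=> Pfx; exists (f x) => //=; rewrite mem_enum.
by move=> [i /=]; rewrite mem_enum => Pi ->.
Qed.

Hypothesis m1 : m setT = 1%E.

Definition label_measure (I : finType) (f : X -> I) (i : I) : R :=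
  fine (m (f @^-1` [set i])).

Lemma fin_num_label (A : set X) : measurable A -> m A \is a fin_num.
Proof.
move=> mA; rewrite ge0_fin_numE// (@le_lt_trans _ _ 1%E) ?ltry// -m1.
by rewrite le_measure ?inE.
Qed.

Lemma label_measureE (I : finType) (f : X -> I) i : fiber_measurable f ->
  m (f @^-1` [set i]) = (label_measure f i)%:E.
Proof. by move=> mf; rewrite fineK// fin_num_label. Qed.

Lemma label_measure_ge0 (I : finType) (f : X -> I) i : 0 <= label_measure f i.
Proof. exact: fine_ge0. Qed.

Lemma sum_label_measure (I : finType) (f : X -> I) :
  fiber_measurable f -> \sum_i label_measure f i = 1.
Proof.
move=> mf; apply: EFin_inj; rewrite -m1 -sumEFin.
rewrite (_ : setT = f @^-1` [set i | predT i]); last by apply/seteqP; split.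
by rewrite measure_preimage_sum//; apply: eq_bigr => i _; rewrite label_measureE.
Qed.

Lemma label_measure_le1 (I : finType) (f : X -> I) i :
  fiber_measurable f -> label_measure f i <= 1.
Proof.
move=> mf; rewrite -(sum_label_measure mf) (bigD1 i)//= lerDl.
by apply: sumr_ge0 => j _; exact: label_measure_ge0.
Qed.

Lemma label_measure_comp (I J : finType) (f : X -> I) (h : I -> J) j :
  fiber_measurable f ->
  label_measure (h \o f) j = \sum_(i | h i == j) label_measure f i.
Proof.
move=> mf; apply: EFin_inj; rewrite -label_measureE; last first.
  exact: fiber_measurable_comp.
rewrite -sumEFin (_ : _ @^-1` _ = f @^-1` [set i | h i == j]); last first.
  by apply/seteqP; split => x /= /eqP.
by rewrite measure_preimage_sum//; apply: eq_bigr => i _; rewrite label_measureE.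
Qed.

Lemma partition_entropyE (I : finType) (f : X -> I) : partition_entropy m f =
  \sum_i - (label_measure f i * ln (label_measure f i)).
Proof. by rewrite /partition_entropy sumrN. Qed.

Lemma partition_entropy_ge0 (I : finType) (f : X -> I) :
  fiber_measurable f -> 0 <= partition_entropy m f.
Proof.
move=> mf; rewrite partition_entropyE sumr_ge0// => i _.
by rewrite -mulrN mulr_ge0 ?label_measure_ge0// oppr_ge0 ln_le0// label_measure_le1.
Qed.

(** Merging labels can only raise the mass that stands inside the logarithm. *)
Lemma partition_entropy_comp (I J : finType) (f : X -> I) (h : I -> J) :
  fiber_measurable f -> partition_entropy m (h \o f) <= partition_entropy m f.
Proof.
move=> mf; rewrite !partition_entropyE !sumrN lerN2.
rewrite (partition_big h predT)//=; apply: ler_sum => j _.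
rewrite {1}label_measure_comp// mulr_suml; apply: ler_sum => i hij.
have := label_measure_ge0 f i; rewrite le_eqVlt => /predU1P[<-|fi0].
  by rewrite !mul0r.
rewrite ler_pM2l//.
have fi_le : label_measure f i <= label_measure (h \o f) j.
  rewrite label_measure_comp// (bigD1 i)//= lerDl.
  by apply: sumr_ge0 => k _; exact: label_measure_ge0.
by rewrite ler_ln// posrE// (lt_le_trans fi0).
Qed.

(** Nonnegativity of mutual information: the sum of [r ln (p q / r)] is at most that of [p q - r],
    which is 0 on every row. *)
Lemma partition_entropy_pair (I J : finType) (f : X -> I) (g : X -> J) :
  fiber_measurable f -> fiber_measurable g ->
  partition_entropy m (fun x => (f x, g x)) <=
    partition_entropy m f + partition_entropy m g.
Proof.
move=> mf mg; set fg := fun x => _.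
have mfg : fiber_measurable fg by exact: fiber_measurable_pair.
set p := label_measure f; set q := label_measure g; set r := label_measure fg.
have pE i : p i = \sum_j r (i, j).
  rewrite /p (_ : f = fst \o fg)// label_measure_comp//.
  rewrite (eq_bigl (fun u => (u.1 == i) && (true))); last first.
    by move=> u; rewrite andbT.
  rewrite (eq_bigr (fun u => r (u.1, u.2))); last by case.
  by rewrite -(pair_big (pred1 i) predT (fun i j => r (i, j)))/= big_pred1_eq.
have qE j : q j = \sum_i r (i, j).
  rewrite /q (_ : g = snd \o fg)// label_measure_comp//.
  rewrite (eq_bigl (fun u => true && (u.2 == j)))//.
  rewrite (eq_bigr (fun u => r (u.1, u.2))); last by case.
  rewrite -(pair_big predT (pred1 j) (fun i j => r (i, j)))/=.
  by apply: eq_bigr => i _; rewrite big_pred1_eq.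
rewrite !partition_entropyE -/p -/q -/r !sumrN -opprD lerN2 -subr_le0.
rewrite (_ : _ - _ = \sum_i \sum_j r (i, j) * (ln (p i) + ln (q j) - ln (r (i, j)))).
  rewrite (@le_trans _ _ (\sum_i \sum_j (p i * q j - r (i, j))))//.
    apply: ler_sum => i _; apply: ler_sum => j _; apply: mul_ln_prod_le.
    - exact: label_measure_ge0.
    - rewrite pE (bigD1 j)//= lerDl.
      by apply: sumr_ge0 => k _; exact: label_measure_ge0.
    - rewrite qE (bigD1 i)//= lerDl.
      by apply: sumr_ge0 => k _; exact: label_measure_ge0.
  under eq_bigr do rewrite sumrB -mulr_sumr -pE sum_label_measure// mulr1 subrr.
  by rewrite sumr_const mul0rn.
transitivity (\sum_i \sum_j r (i, j) * ln (p i) +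
    \sum_i \sum_j r (i, j) * ln (q j) - \sum_i \sum_j r (i, j) * ln (r (i, j))).
  congr (_ + _ - _).
  - by apply: eq_bigr => i _; rewrite -mulr_suml -pE.
  - by rewrite exchange_big/=; apply: eq_bigr => j _; rewrite -mulr_suml -qE.
  - by rewrite pair_big/=; apply: eq_bigr => -[].
rewrite -big_split -sumrB/=; apply: eq_bigr => i _.
rewrite -big_split -sumrB/=; apply: eq_bigr => j _; ring.
Qed.

Lemma partition_entropy_join (I J K : finType) (f : X -> I) (g : X -> J)
    (u : X -> K) (h : I -> J -> K) :
  fiber_measurable f -> fiber_measurable g -> (forall x, u x = h (f x) (g x)) ->
  partition_entropy m u <= partition_entropy m f + partition_entropy m g.
Proof.
move=> mf mg uE; apply: le_trans (partition_entropy_pair mf mg).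
rewrite (_ : u = (fun ij => h ij.1 ij.2) \o (fun x => (f x, g x))); last first.
  by apply/funext => x; rewrite uE.
by apply: partition_entropy_comp; exact: fiber_measurable_pair.
Qed.

(** The label [i0] costs at most 1, and by the square root bound every other label costs at most
    [2 * e]. *)
Lemma partition_entropy_concentrated (I : finType) (f : X -> I) i0 (e : R) :
  fiber_measurable f -> 0 <= e ->
  (forall i, i != i0 -> label_measure f i <= e ^+ 2) ->
  partition_entropy m f <= 1 + 2 * e * #|I|%:R.
Proof.
move=> mf e0 small; rewrite partition_entropyE (bigD1 i0)//= lerD//.
  by rewrite neg_mul_ln_le1// label_measure_ge0.
rewrite (@le_trans _ _ (\sum_(i | i != i0) 2 * e))//.
  apply: ler_sum => i ii0; apply: neg_mul_ln_le_sqrt => //.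
    exact: label_measure_ge0.
  exact: small.
rewrite sumr_const -[leLHS]mulr_natr ler_wpM2l ?mulr_ge0// ler_nat.
by rewrite max_card.
Qed.

End label_measure.

(** * Convergence of subadditive averages *)

Section fekete.
Variables (R : realType) (a : nat -> R).
Hypotheses (a_ge0 : forall n, 0 <= a n)
  (a_sub : forall m n, a (m + n)%N <= a m + a n).

Lemma subadditive_mul_le n q r : a (q * n + r)%N <= q%:R * a n + a r.
Proof.
elim: q => [|q IH]; first by rewrite mul0r add0r.
rewrite mulSn -addnA (le_trans (a_sub _ _))// -natr1 mulrDl mul1r.
by rewrite addrAC [leRHS]addrC lerD.
Qed.

(** The limit is the infimum of the ratios: dividing [m] by a nearly optimal [n] leaves a remainder
    term that is bounded, hence negligible against [m]. *)
Lemma fekete : exists l : R, (a n / n%:R) @[n --> \oo] --> l.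
Proof.
(* [n = 0] is left out because [a 0 / 0] is 0 by convention. *)
pose D := [set x | exists2 n, (0 < n)%N & x = a n / n%:R].
have D_inf : has_inf D.
  split; first by exists (a 1%N / 1); exists 1%N.
  by exists 0 => _ [n _ ->]; rewrite divr_ge0.
exists (inf D); apply/cvgrPdist_le => e e0.
have e20 : 0 < e / 2 by rewrite divr_gt0.
have [_ [n n0 ->] an] := inf_adherent e20 D_inf.
(* [B] dominates [a r] for every possible remainder [r < n]. *)
pose B := \sum_(r < n) a r.
have B0 : 0 <= B by exact: sumr_ge0.
near=> m.
have m0 : (0 < m)%N by near: m; exact: nbhs_infty_gt.
have m0R : 0 < m%:R :> R by rewrite ltr0n.
have n0R : 0 < n%:R :> R by rewrite ltr0n.
have Bm : B / m%:R <= e / 2.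
  rewrite ler_pdivrMr// mulrC -ler_pdivrMr//.
  by near: m; exact: nbhs_infty_ger.
have infm : inf D <= a m / m%:R by apply: ge_inf; [exact: D_inf.2|exists m].
rewrite distrC ger0_norm ?subr_ge0// lerBlDl.
have am : a m <= (m %/ n)%:R * a n + B.
  rewrite {1}(divn_eq m n) (le_trans (subadditive_mul_le _ _ _))// lerD2l.
  have mn : (m %% n < n)%N by rewrite ltn_mod.
  by rewrite /B (bigD1 (Ordinal mn))//= lerDl sumr_ge0.
have : a m / m%:R <= a n / n%:R + B / m%:R.
  rewrite ler_pdivrMr// mulrDl mulfVK ?gt_eqF// (le_trans am)// lerD2r.
  rewrite mulrAC ler_pdivlMr// mulrAC [leRHS]mulrC ler_wpM2r//.
  by rewrite -natrM ler_nat leq_trunc_div.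
by move: an Bm; lra.
Unshelve. all: by end_near. Qed.

End fekete.

Lemma partition_entropy_precomp d d' (X : measurableType d)
    (Y : measurableType d') (R : realType) (m : {measure set X -> \bar R})
    (m' : {measure set Y -> \bar R}) (T : X -> Y) (I : finType) (f : Y -> I) :
  measure_preserving m m' T -> fiber_measurable f ->
  partition_entropy m (f \o T) = partition_entropy m' f.
Proof.
move=> [mT T_m] mf; rewrite /partition_entropy; congr (- _).
by apply: eq_bigr => i _; rewrite comp_preimage T_m.
Qed.

Section entropy_rate.
Context d (X : measurableType d) (R : realType).
Variables (m : {measure set X -> \bar R}) (T : X -> X).
Hypotheses (m1 : m setT = 1%E) (T_m : measure_preserving m m T).

Lemma fiber_measurable_itinerary (I : finType) (f : X -> I) n :
  fiber_measurable f -> fiber_measurable (itinerary T f n).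
Proof.
move=> mf.
apply: (@fiber_measurable_ffun _ _ _ _ (fun j : 'I_n => f \o iter j T)) => j.
by apply: fiber_measurable_precomp => //; exact: (measure_preserving_iter _ T_m).1.
Qed.

(** An itinerary of length [n + k] is one of length [n] followed by one of length [k] read from the
    [n]-th iterate, and that iterate preserves [m]. *)
Lemma partition_entropy_itinerary_add (I : finType) (f : X -> I) n k :
  fiber_measurable f -> partition_entropy m (itinerary T f (n + k)) <=
    partition_entropy m (itinerary T f n) + partition_entropy m (itinerary T f k).
Proof.
move=> mf; have Tn := measure_preserving_iter n T_m.
have mk := fiber_measurable_itinerary (n:=k) mf.
rewrite -(partition_entropy_precomp Tn mk).
apply: (partition_entropy_join m1 (g := itinerary T f k \o iter n T)
  (h := fun (u : {ffun 'I_n -> I}) (v : {ffun 'I_k -> I}) =>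
  [ffun j : 'I_(n + k) => match fintype.split j with inl i => u i | inr i => v i end])).
- exact: fiber_measurable_itinerary.
- exact: fiber_measurable_precomp Tn.1 mk.
- move=> x; apply/ffunP => j; rewrite !ffunE.
  by case: splitP => i ->; rewrite !ffunE//= addnC iterD.
Qed.

Lemma partition_entropy_itinerary_le (I : finType) (f : X -> I) n :
  fiber_measurable f ->
  partition_entropy m (itinerary T f n) <= partition_entropy m f *+ n.
Proof.
move=> mf; elim: n => [|n IH].
  (* There is only one itinerary of length 0, so it has mass 1 and entropy 0. *)
  rewrite mulr0n partition_entropyE big1// => i _.
  rewrite (_ : label_measure _ _ _ = 1) ?ln1 ?mulr0 ?oppr0//.
  rewrite -(sum_label_measure m1 (fiber_measurable_itinerary (n:=0) mf)) (bigD1 i)//=.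
  rewrite big1 ?addr0// => j /eqP []; apply/ffunP => -[]//.
rewrite -addn1 (le_trans (partition_entropy_itinerary_add _ _ mf))//.
rewrite mulrnDr lerD// mulr1n.
rewrite (_ : itinerary T f 1 = (fun i => [ffun=> i]) \o f).
  exact: partition_entropy_comp.
by apply/funext => x; apply/ffunP => j; rewrite !ffunE (ord1 j).
Qed.

(** By Fekete's lemma the [limn] that defines the rate is a genuine finite limit, so that rates can
    be compared through their terms. *)
Lemma partition_entropy_rate_cvg (I : finType) (f : X -> I) :
  fiber_measurable f -> exists l : R,
    (partition_entropy m (itinerary T f n) / n%:R) @[n --> \oo] --> l /\
    partition_entropy_rate m T f = l%:E.
Proof.
move=> mf; have [n|n k|l al] := @fekete R (fun n => partition_entropy m (itinerary T f n)).
- by apply: partition_entropy_ge0 => //; exact: fiber_measurable_itinerary.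
- exact: partition_entropy_itinerary_add.
- by exists l; split => //; apply/cvg_lim => //; apply: cvg_EFin al; exact: nearW.
Qed.

End entropy_rate.

(* K accounts for a label whose future is determined by its present value, and
   c for an approximation error per unit of time. *)
Lemma entropy_le_addr d d' (X : measurableType d) (Y : measurableType d')
    (R : realType) (m : {measure set X -> \bar R}) (m' : {measure set Y -> \bar R})
    (T : X -> X) (S : Y -> Y) (c : R) :
  m setT = 1%E -> m' setT = 1%E ->
  measure_preserving m m T -> measure_preserving m' m' S ->
  (forall n (xi : Y -> 'I_n), fiber_measurable xi ->
    exists (I : finType) (alpha : X -> I) (K : R), fiber_measurable alpha /\
      forall k, partition_entropy m' (itinerary S xi k) <=
        partition_entropy m (itinerary T alpha k) + K + c *+ k) ->
  (entropy m' S <= entropy m T + c%:E)%E.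
Proof.
move=> m1 m1' T_m S_m bound; apply: ub_ereal_sup => _ [n [xi [mxi ->]]].
have [I [alpha [K [malpha hK]]]] := bound n xi mxi.
(* [entropy] ranges over labels in ordinals, so [alpha] is renumbered; [beta] determines it. *)
pose beta : X -> 'I_#|I| := enum_rank \o alpha.
have mbeta : fiber_measurable beta by exact: fiber_measurable_comp.
have alpha_beta k : partition_entropy m (itinerary T alpha k) <=
    partition_entropy m (itinerary T beta k).
  rewrite (_ : itinerary T alpha k =
      (fun u : {ffun 'I_k -> 'I_#|I|} => [ffun j => enum_val (u j)]) \o
      itinerary T beta k).
    by apply: partition_entropy_comp => //; exact: (fiber_measurable_itinerary T_m mbeta).
  by apply/funext => x; apply/ffunP => j; rewrite /= !ffunE enum_rankK.
have [l [cvl ->]] := partition_entropy_rate_cvg m1' S_m mxi.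
have [l' [cvl' lE]] := partition_entropy_rate_cvg m1 T_m mbeta.
have l'h : (l'%:E <= entropy m T)%E.
  by apply: ereal_sup_ubound; exists #|I|, beta; rewrite lE.
apply: le_trans (leeD2r _ l'h); rewrite -EFinD lee_fin.
have cvK : (K / n%:R) @[n --> \oo] --> (0 : R).
  rewrite -(mulr0 K); apply: cvgM; first exact: cvg_cst.
  by apply/gtr0_cvgV0; [near=> k; rewrite ltr0n; near: k; exact: nbhs_infty_gt
    |exact/cvgrnyP].
rewrite -[l'](addr0).
have cvr := cvgD (cvgD cvl' cvK) (@cvg_cst _ c _ \oo _).
apply: (ler_cvg_to cvl (cvr _ _ _)); near=> k.
have k0 : (0 < k)%N by near: k; exact: nbhs_infty_gt.
have k0R : 0 < k%:R :> R by rewrite ltr0n.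
rewrite ler_pdivrMr// (le_trans (hK k))//.
rewrite [leRHS](_ : _ = (partition_entropy m (itinerary T beta k) / k%:R +
  K / k%:R + c) * k%:R)//.
by rewrite !mulrDl !mulfVK ?gt_eqF// mulr_natr !lerD2r.
Unshelve. all: by end_near. Qed.

(** * The odometer *)

(** Adding [p.-1] undoes the successor modulo [p]; hence preimages of cylinders under the odometer
    map are cylinders. *)
Lemma modn_succ_inv p v w : (0 < p)%N -> (v < p)%N -> (w < p)%N ->
  (v.+1 %% p == w)%N = (v == (w + p.-1) %% p)%N.
Proof.
move=> p0 vp wp; have [e|ne] := eqVneq v.+1 p.
  rewrite e modnn; have [<-|w0] := eqVneq 0%N w.
    by rewrite add0n modn_small ?prednK// -e eqxx.
  rewrite (_ : (w + p.-1)%N = (w.-1 + p)%N); last by lia.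
  by rewrite modnDr modn_small; lia.
have v1 : (v.+1 < p)%N by rewrite ltn_neqAle ne.
rewrite modn_small//.
have [->|w0] := eqVneq w 0%N; first by rewrite add0n modn_small; lia.
rewrite (_ : (w + p.-1)%N = (w.-1 + p)%N); last by lia.
by rewrite modnDr modn_small; lia.
Qed.

Lemma eqn_euclid p a a' w w' : (w < p)%N -> (w' < p)%N ->
  (a * p + w == a' * p + w')%N = (a == a') && (w == w').
Proof.
move=> wp wp'; have p0 : (0 < p)%N by exact: leq_ltn_trans wp.
apply/eqP/andP => [h|[/eqP -> /eqP ->]//].
have := congr1 (divn^~ p) h; rewrite /= !divnMDl// !divn_small// !addn0 => aa'.
by move: h; rewrite aa' => /addnI ->.
Qed.

Lemma modn_congr m n d : m = n %[mod d] -> m.+1 = n.+1 %[mod d].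
Proof. by move=> e; rewrite -addn1 -(addn1 n) -modnDml e modnDml. Qed.

Lemma exists_pushforward d d' (X : measurableType d) (Y : measurableType d')
    (R : realType) (m : {measure set X -> \bar R}) (f : X -> Y) :
  measurable_fun setT f ->
  exists m' : {measure set Y -> \bar R}, forall A, m' A = m (f @^-1` A).
Proof. by move=> mf; unshelve eexists (pushforward m f). Qed.

Lemma exists_probability d (X : measurableType d) (R : realType)
    (m : {measure set X -> \bar R}) :
  m setT = 1%E -> exists P : probability X R, forall A, P A = m A.
Proof.
move=> m1; have mE A : mnormalize m (dirac (point : X)) A = m A.
  by rewrite /mnormalize m1 onee_eq0/= invr1 mule1.
by exists (mnormalize m (dirac (point : X))).
Qed.

Lemma val_Zp_succ m (x : 'Z_m) : (1 < m)%N -> val (x + 1) = (x.+1 %% m)%N.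
Proof. by case: m x => [|[|m]]//= x _; rewrite modnDmr addn1. Qed.

Lemma Zp_eqN1 m (x : 'Z_m) : (1 < m)%N -> (x == -1) = (x.+1 == m).
Proof.
move=> m1; rewrite -subr_eq0 opprK -val_eqE val_Zp_succ//.
have : (x < m)%N by rewrite -[X in (_ < X)%N]Zp_cast.
rewrite leq_eqVlt => /predU1P[->|xm]; first by rewrite modnn !eqxx.
by rewrite modn_small// (ltn_eqF xm).
Qed.

(** * Residues of odometer points modulo the partial products *)

Section radix.
Variable k : nat -> nat.
Hypothesis k2 : forall n, (2 <= k n)%N.

Definition radix n := (\prod_(i < n) k i)%N.

Lemma radixS n : radix n.+1 = (radix n * k n)%N.
Proof. by rewrite /radix big_ord_recr. Qed.

Lemma radix_gt0 n : (0 < radix n)%N.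
Proof. by rewrite prodn_gt0// => i; rewrite (leq_trans _ (k2 i)). Qed.

Lemma radix_dvd m n : (m <= n)%N -> (radix m %| radix n)%N.
Proof.
move/subnK <-; elim: (n - m)%N => [|j IH]; first by rewrite add0n.
by rewrite addSn radixS dvdn_mulr.
Qed.

Implicit Types y z : odometer k.

(* The image of y in Z/(radix n)Z, when the odometer is seen as the inverse
   limit of these groups. *)
Definition odometer_value n y := (\sum_(i < n) y i * radix i)%N.

Lemma odometer_valueS n y :
  odometer_value n.+1 y = (odometer_value n y + y n * radix n)%N.
Proof. by rewrite /odometer_value big_ord_recr. Qed.

Lemma digit_lt y n : (y n < k n)%N.
Proof. by rewrite -[X in (_ < X)%N]Zp_cast. Qed.

Lemma odometer_value_lt n y : (odometer_value n y < radix n)%N.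
Proof.
elim: n => [|n IH]; first by rewrite /odometer_value /radix !big_ord0.
rewrite odometer_valueS radixS.
have := digit_lt y n; move: (radix n) (odometer_value n y) IH => p v vp yk.
have : (y n * p + p <= p * k n)%N by rewrite addnC -mulSn mulnC leq_mul.
by lia.
Qed.

(** Compatibility of the maps of the inverse limit: the digits from [m] on contribute multiples of
    [radix m]. *)
Lemma odometer_value_mod m n y : (m <= n)%N ->
  odometer_value m y = (odometer_value n y %% radix m)%N.
Proof.
move=> mn; rewrite -(subnK mn); elim: (n - m)%N => [|j IH].
  by rewrite add0n modn_small// odometer_value_lt.
rewrite addSn odometer_valueS IH -modnDmr.
have /dvdnP[q ->] := radix_dvd (leq_addl j m).
by rewrite mulnA modnMl addn0.
Qed.

Lemma odometer_value_digit n y : y n = (odometer_value n.+1 y %/ radix n)%N :> nat.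
Proof.
rewrite odometer_valueS addnC divnMDl ?radix_gt0// divn_small ?addn0//.
exact: odometer_value_lt.
Qed.

Lemma odometer_value_inj y z :
  (forall n, odometer_value n y = odometer_value n z) -> y = z.
Proof.
move=> yz; apply: functional_extensionality_dep => n; apply/val_inj => /=.
by rewrite !odometer_value_digit yz.
Qed.

(** Converts the carry condition of [odometer_map] into arithmetic on residues. *)
Lemma odometer_value_max n y :
  [forall j : 'I_n, y j == -1] = ((odometer_value n y).+1 == radix n).
Proof.
elim: n => [|n IH].
  rewrite /odometer_value /radix !big_ord0 eqxx; apply/forallP => -[]//.
have -> : [forall j : 'I_n.+1, y j == -1] =
    [forall j : 'I_n, y j == -1] && (y n == -1).
  apply/forallP/andP => [h|[/forallP h hn] j].
    split; last exact: (h ord_max).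
    by apply/forallP => j; exact: (h (widen_ord (leqnSn n) j)).
  have [jn|] := ltnP j n; first exact: (h (Ordinal jn)).
  move: (j) (ltn_ord j) => [i ilt] /= _ ni.
  by have -> : i = n by apply/eqP; rewrite eqn_leq ni -ltnS ilt.
rewrite {}IH Zp_eqN1; last exact: k2.
rewrite odometer_valueS radixS; move: (odometer_value_lt n y) (digit_lt y n).
move: (radix n) (odometer_value n y) (nat_of_ord (y n)) => p v a vp ak.
apply/andP/eqP => [[/eqP <- /eqP <-]|e]; first by rewrite mulnC; lia.
have [h|h] := eqVneq a.+1 (k n); last first.
  have h2 : (a.+2 * p <= k n * p)%N by rewrite leq_mul2r; lia.
  by rewrite mulnC in e; lia.
by split => //; apply/eqP; rewrite -h in e; lia.
Qed.

(** Digit [n] is incremented exactly when the value of the digits before it wraps around to 0. *)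
Lemma odometer_value_map n y :
  odometer_value n (odometer_map y) = ((odometer_value n y).+1 %% radix n)%N.
Proof.
elim: n => [|n IH]; first by rewrite /odometer_value /radix !big_ord0 modn1.
rewrite !odometer_valueS radixS IH /odometer_map odometer_value_max.
have vlt := odometer_value_lt n y; have alt := digit_lt y n.
have [e|ne] := eqVneq.
  rewrite val_Zp_succ//.
  by rewrite -addSn e modnn add0n -mulSn (mulnC (radix n)) muln_modl.
have v1 : ((odometer_value n y).+1 < radix n)%N by rewrite ltn_neqAle ne.
rewrite modn_small// modn_small; first by rewrite addSn.
have : ((y n).+1 * radix n <= k n * radix n)%N by rewrite leq_mul2r alt orbT.
rewrite (mulnC (radix n)); lia.
Qed.

End radix.

Lemma odometer_value_iter (k : nat -> nat) (k2 : forall n, (2 <= k n)%N) n j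
    (y : odometer k) :
  odometer_value n (iter j (@odometer_map k) y) =
  ((odometer_value n y + j) %% radix k n)%N.
Proof.
elim: j => [|j IH]; first by rewrite addn0 modn_small// odometer_value_lt.
by rewrite iterS odometer_value_map// IH -addn1 modnDml addn1 addnS.
Qed.

Section odometer_inverse.
Variable k : nat -> nat.

(* odometer_map is the exchange of -1 and 0 in this sense, and its inverse the
   opposite exchange. *)
Definition carry_exchange (a b : odometer k) (y : odometer k) : odometer k :=
  fun n => if [forall j : 'I_n, y j == a j] then y n + (b n - a n) else y n.

(** By strong induction the digits before [i] satisfy the carry condition, so digit [i] has been
    shifted by [b i - a i]. Thus the opposite exchange applies the reverse shift at the same
    places. *)
Lemma carry_exchange_prefix (a b y : odometer k) n :
  [forall j : 'I_n, carry_exchange a b y j == b j] = [forall j : 'I_n, y j == a j].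
Proof.
apply/forallP/forallP => h j.
  suff : forall i, (i < n)%N -> y i = a i by move=> ->.
  move=> i; elim/ltn_ind: i => i IH ilt; have /eqP := h (Ordinal ilt).
  rewrite /carry_exchange ifT; last first.
    by apply/forallP => l; rewrite IH// (ltn_trans _ ilt).
  by rewrite addrCA => /(canRL (addKr _)); rewrite addNr => /subr0_eq.
rewrite /carry_exchange ifT => [|]; first by rewrite (eqP (h j)) addrC subrK.
by apply/forallP => l; exact: (h (widen_ord (ltnW (ltn_ord j)) l)).
Qed.

Lemma carry_exchangeK a b : cancel (carry_exchange a b) (carry_exchange b a).
Proof.
move=> y; apply: functional_extensionality_dep => n.
rewrite {1}/carry_exchange carry_exchange_prefix /carry_exchange.
by case: [forall _, _] => //; rewrite -[b n - a n]opprB subrK.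
Qed.

Definition odometer_inv : odometer k -> odometer k :=
  carry_exchange (fun=> 0) (fun=> -1).

Lemma odometer_mapE : @odometer_map k = carry_exchange (fun=> -1) (fun=> 0).
Proof.
apply/funext => y; apply: functional_extensionality_dep => n.
by rewrite /carry_exchange sub0r opprK.
Qed.

Lemma odometer_mapK : cancel (@odometer_map k) odometer_inv.
Proof. by rewrite odometer_mapE; exact: carry_exchangeK. Qed.

Lemma odometer_invK : cancel odometer_inv (@odometer_map k).
Proof. by rewrite odometer_mapE; exact: carry_exchangeK. Qed.

End odometer_inverse.

(** * Cylinders, and the invariance of the Haar measure *)

Section odometer_measurable.
Variable k : nat -> nat.
Hypothesis k2 : forall n, (2 <= k n)%N.

Lemma fiber_measurable_digit n : fiber_measurable (fun y : odometer k => y n).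
Proof. by move=> a; apply: sub_sigma_algebra; exists n, a. Qed.

Lemma fiber_measurable_odometer_value n :
  fiber_measurable (@odometer_value k n).
Proof.
elim: n => [|n IH].
  rewrite (_ : odometer_value 0 = (fun=> 0%N)); last first.
    by apply/funext => y; rewrite /odometer_value big_ord0.
  move=> i; have [->|i0] := eqVneq i 0%N.
    by rewrite (_ : _ @^-1` _ = setT)//; apply/seteqP; split.
  rewrite (_ : _ @^-1` _ = set0)//; apply/seteqP; split => // y /= e.
  by rewrite e eqxx in i0.
rewrite (_ : odometer_value n.+1 = (fun u => (u.1 + u.2 * radix k n)%N) \o
    (fun y : odometer k => (odometer_value n y, y n : nat))); last first.
  by apply/funext => y; rewrite odometer_valueS.
apply: fiber_measurable_comp; apply: fiber_measurable_pair => //.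
rewrite (_ : (fun y => _) =
    (fun i : 'Z_(k n) => i : nat) \o (fun y : odometer k => y n))//.
exact: fiber_measurable_comp (@fiber_measurable_digit n).
Qed.

(** Enough because digit [n] is a quotient of [odometer_value n.+1]. *)
Lemma measurable_fun_odometer d (X : measurableType d) (f : X -> odometer k) :
  (forall n, fiber_measurable (fun x => odometer_value n (f x))) ->
  measurable_fun setT f.
Proof.
move=> mf; apply: (@measurability _ _ _ _ setT f (@coordinate_sets k)) => //.
move=> _ [_ [n [a ->]] <-].
rewrite setTI (_ : _ @^-1` _ = (fun x => odometer_value n.+1 (f x)) @^-1`
    [set v | (v %/ radix k n)%N = a]); first exact: fiber_measurable_preimage.
apply/seteqP; split => x /=; first by rewrite -odometer_value_digit// => ->.
by rewrite -odometer_value_digit// => /val_inj.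
Qed.

Lemma measurable_odometer_map : measurable_fun setT (@odometer_map k).
Proof.
apply: measurable_fun_odometer => n.
rewrite (_ : (fun x => _) = (fun v => v.+1 %% radix k n)%N \o odometer_value n).
  exact: fiber_measurable_comp (@fiber_measurable_odometer_value n).
by apply/funext => y /=; rewrite odometer_value_map.
Qed.

Lemma measurable_odometer_inv : measurable_fun setT (@odometer_inv k).
Proof.
apply: measurable_fun_odometer => n.
rewrite (_ : (fun x => _) =
    (fun v => (v + (radix k n).-1) %% radix k n)%N \o odometer_value n).
  exact: fiber_measurable_comp (@fiber_measurable_odometer_value n).
apply/funext => y /=; apply/eqP; rewrite -modn_succ_inv.
- by rewrite -odometer_value_map// odometer_invK.
- exact: radix_gt0.
- exact: odometer_value_lt.
- exact: odometer_value_lt.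
Qed.

(** A value determines all shorter ones, so two cylinders are nested or disjoint. *)
Lemma odometer_valueI m n v w : (m <= n)%N ->
  [set y : odometer k | odometer_value m y = v] `&`
    [set y | odometer_value n y = w] =
  if (w %% radix k m == v)%N then [set y | odometer_value n y = w] else set0.
Proof.
move=> mn; case: eqVneq => [wv|wv]; apply/seteqP; split => y //=.
- by case.
- by move=> yw; split => //; rewrite (odometer_value_mod k2 y mn) yw.
- by move=> [yv yw]; move: wv; rewrite -yw -yv (odometer_value_mod k2 y mn) eqxx.
Qed.

(** No bound is put on [v]: values out of range give the empty set, which closure under
    intersections requires. *)
Definition odometer_cylinders : set (set (odometer k)) :=
  [set C | exists n v, C = [set y | odometer_value n y = v]].

Lemma odometer_cylinders_set0 : odometer_cylinders set0.
Proof.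
exists 0%N, 1%N; apply/seteqP; split => // y /=.
by rewrite /odometer_value big_ord0.
Qed.

Lemma odometer_cylinders_setT : odometer_cylinders setT.
Proof.
exists 0%N, 0%N; apply/seteqP; split => // y /= _.
by rewrite /odometer_value big_ord0.
Qed.

Lemma odometer_cylinders_setI : setI_closed odometer_cylinders.
Proof.
move=> _ _ [m [v ->]] [n [w ->]]; have [mn|/ltnW nm] := leqP m n.
  by rewrite odometer_valueI//; case: ifP => _;
    [exists n, w|exact: odometer_cylinders_set0].
by rewrite setIC odometer_valueI//; case: ifP => _;
  [exists m, v|exact: odometer_cylinders_set0].
Qed.

Lemma odometer_measurableE : @measurable _ (odometer k) = <<s odometer_cylinders >>.
Proof.
apply/seteqP; split.
  apply: smallest_sub => [|_ [n [a ->]]]; first exact: smallest_sigma_algebra.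
  rewrite (_ : mkset _ = \bigcup_v
      (if (v %/ radix k n)%N == a then [set y | odometer_value n.+1 y = v] else set0)).
    apply: sigma_algebra_bigcup => v; case: ifP => _; apply: sub_sigma_algebra.
      by exists n.+1, v.
    exact: odometer_cylinders_set0.
  apply/seteqP; split => y /=.
    by move=> <-; exists (odometer_value n.+1 y); rewrite // -odometer_value_digit// eqxx.
  move=> [v _]; case: ifP => // /eqP va /= yv; apply/val_inj => /=.
  by rewrite odometer_value_digit// yv.
apply: smallest_sub => [|_ [n [v ->]]]; first exact: sigma_algebra_measurable.
exact: fiber_measurable_odometer_value.
Qed.

Variable R : realType.

Lemma odometer_measure_unique (m m' : {measure set (odometer k) -> \bar R}) :
  (m setT < +oo)%E ->
  (forall n v, m [set y | odometer_value n y = v] = m' [set y | odometer_value n y = v]) ->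
  forall A, measurable A -> m A = m' A.
Proof.
move=> mT mm' A mA; apply: (measure_unique odometer_cylinders (fun=> setT)) => //.
- exact: odometer_measurableE.
- exact: odometer_cylinders_setI.
- by move=> i; exact: odometer_cylinders_setT.
- by rewrite bigcup_const.
- by move=> _ [n [v ->]].
Qed.

(** The Haar measure read on the quotients [Z / radix k n], a handier form than boxes of digits;
    [uniform_values_is_odometer] recovers the latter. *)
Definition uniform_values (nu : {measure set (odometer k) -> \bar R}) : Prop :=
  forall n v, (v < radix k n)%N ->
    nu [set y | odometer_value n y = v] = ((radix k n)%:R^-1)%:E.

Lemma uniform_values_setT nu : uniform_values nu -> nu setT = 1%E.
Proof.
move=> /(_ 0%N 0%N); rewrite radix_gt0// => /(_ isT).
rewrite /radix big_ord0 invr1 => <-; congr (nu _).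
by apply/seteqP; split => // y _ /=; rewrite /odometer_value big_ord0.
Qed.

(** Translation by one permutes the cylinders of each length, which all have the same mass, and
    measures that agree on cylinders agree. *)
Lemma odometer_map_preserving nu : uniform_values nu ->
  measure_preserving nu nu (@odometer_map k).
Proof.
move=> unif; split; first exact: measurable_odometer_map.
move=> B mB.
have [m' m'E] := exists_pushforward nu measurable_odometer_map.
rewrite -m'E; apply/esym; apply: odometer_measure_unique => //.
  by rewrite uniform_values_setT// ltry.
move=> n v; rewrite m'E.
have [vlt|vge] := ltnP v (radix k n); last first.
  rewrite (_ : mkset _ = set0); last first.
    apply/seteqP; split => // y /= yv.
    by have := odometer_value_lt k2 n y; rewrite yv ltnNge vge.
  by rewrite preimage_set0.
rewrite (_ : _ @^-1` _ =
    [set y | odometer_value n y = ((v + (radix k n).-1) %% radix k n)%N]).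
  by rewrite !unif// ltn_mod radix_gt0.
apply/seteqP; split => y /=; rewrite odometer_value_map// => /eqP.
  by rewrite modn_succ_inv ?radix_gt0 ?odometer_value_lt// => /eqP.
by rewrite -modn_succ_inv ?radix_gt0 ?odometer_value_lt// => /eqP.
Qed.

End odometer_measurable.

(** * Existence of the Haar measure *)

Section uniform_odometer.
Variables (k : nat -> nat) (R : realType).
Hypothesis k2 : forall n, (2 <= k n)%N.

Lemma radix_natr_gt0 n : 0 < (radix k n)%:R :> R.
Proof. by rewrite ltr0n radix_gt0. Qed.

Lemma uniform_values_is_odometer (nu : probability (odometer k) R) :
  uniform_values nu -> is_odometer nu.
Proof.
move=> unif; split=> // n A.
have mcyl (B : forall i, {set 'Z_(k i)}) :
    measurable [set y : odometer k | forall i, (i < n)%N -> y i \in B i].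
  rewrite (_ : mkset _ = \bigcap_(i in [set i | (i < n)%N])
      [set y : odometer k | y i \in B i]); last first.
    by apply/seteqP; split.
  apply: bigcap_measurableType => i _.
  exact: (fiber_measurable_preimage [set a | a \in B i]
    (@fiber_measurable_digit k i)).
(* Induction on the number [m] of leading coordinates whose sets are arbitrary; the other sets are
   singletons, and for [m = 0] the box is a single cylinder. *)
suff H m (B : forall i, {set 'Z_(k i)}) : (m <= n)%N ->
    (forall i, (m <= i < n)%N -> exists a, B i = [set a]%SET) ->
    nu [set y | forall i, (i < n)%N -> y i \in B i] =
    (\prod_(i < n) (#|B i|%:R / (k i)%:R))%:E.
  by apply: (H n) => // i; rewrite leqNgt andNb.
elim: m B => [|m IH] B mn Bsingle.
  have [a Ba] : exists a : odometer k, forall i, (i < n)%N -> B i = [set a i]%SET.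
    exists (fun i => odflt 0 [pick b in B i]) => i /Bsingle[b ->].
    by case: pickP => [c /set1P ->//|/(_ b)]; rewrite set11.
  rewrite (_ : mkset _ = [set y | odometer_value n y = odometer_value n a]).
    rewrite unif ?odometer_value_lt//; congr EFin.
    rewrite /radix natr_prod -prodfV; apply: eq_bigr => i _.
    by rewrite Ba// cards1 mul1r.
  apply/seteqP; split => y /= hy.
    by apply: eq_bigr => i _; have := hy _ (ltn_ord i); rewrite Ba// => /set1P ->.
  move=> i ilt; rewrite Ba//; apply/set1P/val_inj => /=.
  by rewrite !odometer_value_digit// !(odometer_value_mod k2 _ ilt) hy.
(* [BC C] replaces the set at coordinate [m]; [E] leaves that coordinate free, and additivity is
   then applied to [nu] restricted to [E]. *)
pose BC C := dfwith B m C.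
pose E := [set y : odometer k | forall i, (i < n)%N -> y i \in BC [set: 'Z_(k m)]%SET i].
have mE : measurable E by exact: mcyl.
have EB (C : {set 'Z_(k m)}) : [set y : odometer k | y m \in C] `&` E =
    [set y | forall i, (i < n)%N -> y i \in BC C i].
  apply/seteqP; split => y /=.
    move=> [ym yE] i ilt; have := yE i ilt; rewrite /BC.
    by case: dfwithP => [_|j mj]; rewrite ?dfwithin ?dfwithout.
  move=> yC; split=> [|i ilt]; first by have := yC m mn; rewrite /BC dfwithin.
  have := yC i ilt; rewrite /BC.
  by case: dfwithP => [|j mj]; rewrite ?dfwithin ?dfwithout// inE.
have BE : BC (B m) = B.
  by apply: functional_extensionality_dep => i; rewrite /BC; case: dfwithP.
have prodBC (C : {set 'Z_(k m)}) :
    \prod_(i < n) (#|BC C i|%:R / (k i)%:R) =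
    #|C|%:R / (k m)%:R * \prod_(i < n | i != Ordinal mn) (#|B i|%:R / (k i)%:R) :> R.
  rewrite (bigD1 (Ordinal mn))//= /BC dfwithin; congr (_ * _).
  by apply: eq_bigr => i im; rewrite dfwithout// eq_sym.
rewrite -{1}BE -EB -[LHS]/(mrestr nu mE _).
rewrite (@measure_preimage_sum _ _ _ (mrestr nu mE) _ (fun y : odometer k => y m)
  (mem (B m)))//; last exact: fiber_measurable_digit.
rewrite (eq_bigr (fun=> (1 / (k m)%:R *
    \prod_(i < n | i != Ordinal mn) (#|B i|%:R / (k i)%:R))%:E)); last first.
  move=> a _; rewrite /mrestr.
  rewrite (_ : _ @^-1` _ = [set y : odometer k | y m \in [set a]%SET]); last first.
    by apply/seteqP; split => y /=; [move=> ->; rewrite set11|move/set1P].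
  rewrite -[LHS]/(nu (_ `&` _)) EB IH ?prodBC ?cards1 ?(ltnW mn)//= => i /andP[mi ilt].
  rewrite /BC; case: dfwithP ilt mi => [_ _|j mj jn mj']; first by exists a.
  by apply: Bsingle; rewrite jn ltn_neqAle mj mj'.
rewrite sumEFin -[in RHS]BE prodBC sumr_const; congr EFin.
by rewrite -[LHS]mulr_natl mul1r mulrA.
Qed.

(** For [x] in [[0, 1)], the digits of its expansion in the mixed radix [k]; [inZp] performs the
    reduction modulo [k n]. *)
Definition lebesgue_digits (x : R) : odometer k :=
  fun n => inZp (Num.truncn (x * (radix k n.+1)%:R)).

Lemma fiber_measurable_truncn (c : R) : 0 < c ->
  fiber_measurable (fun x : R => Num.truncn (x * c)).
Proof.
move=> c0; have mle n : measurable [set x : R | (Num.truncn (x * c) <= n)%N].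
  rewrite (_ : mkset _ = [set` `]-oo, (n.+1%:R / c)[]) ?measurable_itv//.
  apply/seteqP; split => x /=;
    by rewrite real_truncn_le_nat ?num_real// in_itv/= ltr_pdivlMr.
case=> [|n].
  rewrite (_ : _ @^-1` _ = [set x : R | (Num.truncn (x * c) <= 0)%N])//.
  by apply/seteqP; split => x /=; [move=> ->|rewrite leqn0 => /eqP].
rewrite (_ : _ @^-1` _ = [set x : R | (Num.truncn (x * c) <= n.+1)%N] `\`
  [set x : R | (Num.truncn (x * c) <= n)%N]); first exact: measurableD.
apply/seteqP; split => x /=; first by move=> ->; rewrite leqnn ltnn.
by move=> [le1 /negP]; rewrite -ltnNge => le2; apply/eqP; rewrite eqn_leq le1.
Qed.

Lemma measurable_lebesgue_digits : measurable_fun setT lebesgue_digits.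
Proof.
apply: (@measurability _ _ _ _ setT lebesgue_digits (@coordinate_sets k)) => //.
move=> _ [_ [n [a ->]] <-]; rewrite setTI.
rewrite (_ : _ @^-1` _ = (fun x => Num.truncn (x * (radix k n.+1)%:R)) @^-1`
  [set v | inZp v = a])//.
apply: fiber_measurable_preimage; apply: fiber_measurable_truncn.
exact: radix_natr_gt0.
Qed.

Lemma truncn_radixS (x : R) n : 0 <= x ->
  Num.truncn (x * (radix k n)%:R) =
  (Num.truncn (x * (radix k n.+1)%:R) %/ k n)%N.
Proof.
move=> x0; set N := Num.truncn (x * (radix k n.+1)%:R).
have k0 : (0 < k n)%N by exact: leq_trans (k2 n).
have xr0 m : 0 <= x * (radix k m)%:R by rewrite mulr_ge0 ?ler0n.
have /andP[Nx xN] := truncn_itv (xr0 n.+1).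
rewrite -/N radixS natrM mulrA in Nx xN.
have k0R : 0 < (k n)%:R :> R by rewrite ltr0n.
apply/eqP; rewrite truncn_eq//; apply/andP; split.
  by rewrite -(ler_pM2r k0R) (le_trans _ Nx)// -natrM ler_nat leq_trunc_div.
rewrite -(ltr_pM2r k0R) (lt_le_trans xN)// -natrM ler_nat.
exact: ltn_ceil.
Qed.

(* The digits of x are read off from the most significant one, whereas
   odometer_value reads them from the least significant one. *)
Lemma lebesgue_digits_cylinder n v : (v < radix k n)%N ->
  exists2 N, (N < radix k n)%N & forall x, 0 <= x < 1 ->
    (odometer_value n (lebesgue_digits x) == v) =
    (Num.truncn (x * (radix k n)%:R) == N).
Proof.
elim: n v => [|n IH] v.
  rewrite /radix big_ord0 ltnS leqn0 => /eqP ->; exists 0%N => // x /andP[x0 x1].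
  by rewrite /odometer_value big_ord0 eqxx mulr1 truncn_eq// x0 x1.
have P0 := radix_gt0 k2 n; have kn0 : (0 < k n)%N by exact: leq_trans (k2 n).
rewrite {1}radixS => vlt.
have [|N NP hN] := IH (v %% radix k n)%N; first by rewrite ltn_mod.
have ak : (v %/ radix k n < k n)%N by rewrite ltn_divLR// mulnC.
(* The top digit of [v] is the last one read in the expansion, so it becomes the lowest digit of the
   index of the interval. *)
exists (N * k n + v %/ radix k n)%N.
  have : (N.+1 * k n <= radix k n * k n)%N by rewrite leq_mul2r NP orbT.
  rewrite radixS mulSn; lia.
move=> x /andP[x0 x1]; have := hN x; rewrite x0 x1 => /(_ isT).
rewrite odometer_valueS truncn_radixS//.
have -> : lebesgue_digits x n =
    (Num.truncn (x * (radix k n.+1)%:R) %% k n)%N :> nat.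
  by rewrite /= Zp_cast.
have wlt := odometer_value_lt k2 n (lebesgue_digits x).
move: (Num.truncn _) => M e.
rewrite [(odometer_value _ _ + _)%N]addnC.
rewrite {1}(divn_eq v (radix k n)) [X in _ = (X == _)](divn_eq M (k n)).
by rewrite !eqn_euclid ?ltn_mod// e andbC.
Qed.

(** The image of Lebesgue measure on [[0, 1)]: a cylinder of length [n] corresponds to an interval
    of length [1 / radix k n]. *)
Lemma exists_uniform_values : exists nu : probability (odometer k) R, uniform_values nu.
Proof.
pose I01 : set R := [set` `[0, 1[].
have mI : measurable I01 by exact: measurable_itv.
have [m' m'E] := exists_pushforward (mrestr (@lebesgue_measure R) mI)
  measurable_lebesgue_digits.
have m'1 : m' setT = 1%E.
  rewrite m'E preimage_setT -[LHS]/(lebesgue_measure (_ `&` _)) setTI.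
  by rewrite lebesgue_measure_itv/= lte01 oppr0 adde0.
have [nu nuE] := exists_probability m'1; exists nu => n v /lebesgue_digits_cylinder.
move=> [N NP hN]; rewrite -[LHS]/(nu _) nuE m'E -[LHS]/(lebesgue_measure (_ `&` _)).
have P0 := radix_natr_gt0 n; set P := (radix k n)%:R : R in P0 *.
rewrite (_ : _ `&` _ = [set` `[(N%:R / P), (N.+1%:R / P)[]); last first.
  apply/seteqP; split => x /=; rewrite !in_itv/= ler_pdivrMr// ltr_pdivlMr//.
    rewrite {1}/I01/= in_itv/= => -[/eqP + x01].
    by rewrite hN// truncn_eq// mulr_ge0 ?(ltW P0)//; case/andP: x01.
  move=> /andP[Nx xN].
  have x0 : 0 <= x by rewrite -(pmulr_lge0 _ P0) (le_trans _ Nx).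
  have x1 : x < 1.
    by rewrite -(ltr_pM2r P0) mul1r (lt_le_trans xN)// ler_nat.
  rewrite {1}/I01/= in_itv/= x0 x1; split => //; apply/eqP.
  by rewrite hN ?x0// truncn_eq ?Nx// mulr_ge0// ltW.
rewrite lebesgue_measure_itv/= lte_fin ltr_pM2r ?invr_gt0// ltr_nat ltnSn.
by rewrite -EFinB -mulrBl -natr1 addrAC subrr add0r mul1r.
Qed.

End uniform_odometer.

(** * Cyclic factors *)

Section almost_everywhere.
Context d (X : measurableType d) (R : realType) (mu : probability X R).

Lemma ae_of_full (D : set X) (P : X -> Prop) :
  measurable D -> mu D = 1%E -> D `<=` P -> {ae mu, forall x, P x}.
Proof.
move=> mD D1 DP; exists (~` D); split; first exact: measurableC.
  by rewrite -[LHS]/(mu _) probability_setC// D1 subee.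
exact: subsetC.
Qed.

Lemma ae_le_measure (A B : set X) : measurable A -> measurable B ->
  {ae mu, forall x, A x -> B x} -> (mu A <= mu B)%E.
Proof.
move=> mA mB [N [mN N0 AB]].
rewrite (@le_trans _ _ (mu (B `|` N)))//.
  rewrite le_measure ?inE//; first exact: measurableU.
  move=> x Ax; have [Bx|nBx] := pselect (B x); [by left|right].
  by apply: AB => /= /(_ Ax).
rewrite (le_trans (measureU2 _ _ _))//.
by rewrite -[X in (_ + X)%E]/(mu N) in N0 *; rewrite N0 adde0.
Qed.

Lemma ae_eq_measure (A B : set X) : measurable A -> measurable B ->
  {ae mu, forall x, A x <-> B x} -> mu A = mu B.
Proof.
move=> mA mB AB; apply/eqP; rewrite eq_le; apply/andP; split;
  by apply: ae_le_measure => //; apply: filterS AB => x [].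
Qed.

Lemma ae_exists (P : X -> Prop) : {ae mu, forall x, P x} -> exists x, P x.
Proof.
move=> [N [mN N0 PN]]; apply: contrapT => noP.
have NT : N = setT.
  by apply/seteqP; split => // x _; apply: PN => /= Px; apply: noP; exists x.
have := probability_setT mu; rewrite -NT => N1.
by have := oner_neq0 R; rewrite -eqe -N1 -[X in X != _]/(mu N) N0 eqxx.
Qed.

End almost_everywhere.

Definition rotate_label (q : nat) (w : {ffun 'I_q -> bool}) : {ffun 'I_q -> bool} :=
  [ffun j => w (ordS j)].

Lemma rotate_label_inj q : injective (@rotate_label q).
Proof.
move=> u w /ffunP uw; apply/ffunP => j.
by have := uw (ord_pred j); rewrite !ffunE ord_predK.
Qed.

Lemma iter_rotate_label q (w : {ffun 'I_q -> bool}) : iter q (@rotate_label q) w = w.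
Proof.
have H m (j : 'I_q) : iter m (@rotate_label q) w j = w (iter m (@ordS q) j).
  by elim: m j => //= m IH j; rewrite ffunE IH -iterSr.
have valS m (j : 'I_q) : iter m (@ordS q) j = ((j + m) %% q)%N :> nat.
  elim: m => [|m IH /=]; first by rewrite addn0 modn_small.
  by rewrite IH addnS -addn1 modnDml addn1.
apply/ffunP => j; rewrite H; congr (w _); apply/val_inj => /=.
by rewrite valS modnDr modn_small.
Qed.

Lemma order_dvd_iter (W : finType) (f : W -> W) w q : injective f ->
  iter q f w = w -> (order f w %| q)%N.
Proof.
move=> injf; have m0 : (0 < order f w)%N by exact: order_gt0.
have iter_mul a : iter (a * order f w) f w = w.
  by elim: a => // a IH; rewrite mulSn iterD IH iter_order.
rewrite {1}(divn_eq q (order f w)) addnC iterD iter_mul => e.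
have h0 : findex f w (iter 0 f w) = 0%N by rewrite findex_iter.
have h1 : findex f w (iter (q %% order f w) f w) = (q %% order f w)%N.
  by rewrite findex_iter// ltn_mod.
by apply/eqP; rewrite -h1 e.
Qed.

Section cyclic_factors.
Context d (X : measurableType d) (R : realType) (mu : probability X R).
Variable T : X -> X.
Hypothesis Terg : ergodic mu T.

(** Only the class of [c] modulo [p] matters. The image measure is left out of the definition
    because [cyclic_factor_uniform] determines it. *)
Definition cyclic_factor (p : nat) : Prop :=
  exists c : X -> nat, fiber_measurable c /\
    {ae mu, forall x, c (T x) = (c x).+1 %[mod p]}.

(** Up to a null set, [T] pulls the fiber over the successor of [v] back to the fiber over [v], so
    all [q] fibers have the same mass. *)
Lemma cyclic_factor_uniform (q : nat) (c : X -> nat) : (0 < q)%N ->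
  fiber_measurable c -> (forall x, (c x < q)%N) ->
  {ae mu, forall x, c (T x) = (c x).+1 %% q}%N ->
  forall v, (v < q)%N -> mu (c @^-1` [set v]) = (q%:R^-1)%:E.
Proof.
move=> q0 mc cq cT; have [[[mT T_mu] _] _] := Terg.
have mcT v : measurable (T @^-1` (c @^-1` [set v])).
  by rewrite -[_ @^-1` _]setTI; exact: mT.
have step v : (v < q)%N -> mu (c @^-1` [set v]) = mu (c @^-1` [set (v.+1 %% q)%N]).
  move=> vq; rewrite -[RHS]T_mu//; apply: ae_eq_measure => //.
  apply: filterS cT => x /= ->; rewrite -[(c x).+1]addn1 -[v.+1]addn1.
  by split => [->//|/eqP]; rewrite eqn_modDr !modn_small// => /eqP.
have all0 v : (v < q)%N -> mu (c @^-1` [set v]) = mu (c @^-1` [set 0%N]).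
  elim: v => // v IH vq; rewrite -[in LHS](modn_small vq) -step ?IH// ltnW//.
pose g x : 'I_q := Ordinal (cq x).
have gE (i : 'I_q) : g @^-1` [set i] = c @^-1` [set val i].
  by apply/seteqP; split => x /=; [move=> <-|move=> cx; exact: val_inj].
have mg : fiber_measurable g by move=> i; rewrite gE.
have := sum_label_measure (probability_setT mu) mg.
rewrite (eq_bigr (fun=> fine (mu (c @^-1` [set 0%N])))); last first.
  by move=> i _; rewrite /label_measure gE -[fine _]/(fine (mu _)) all0 ?ltn_ord.
rewrite sumr_const card_ord => e v vq; rewrite all0//.
rewrite -[LHS]fineK ?fin_num_measure//; congr EFin.
have q0R : q%:R != 0 :> R by rewrite pnatr_eq0 -lt0n.
by apply: (mulfI q0R); rewrite mulr_natl mulfV.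
Qed.

(** As [f] is injective, the preimage of an orbit is strictly invariant, hence null or full; not all
    are null, since the masses of the labels sum to 1. *)
Lemma ergodic_orbit (W : finType) (f : W -> W) (phi : X -> W) :
  injective f -> fiber_measurable phi -> (forall x, phi (T x) = f (phi x)) ->
  exists w, mu (phi @^-1` [set u | fconnect f w u]) = 1%E.
Proof.
move=> injf mphi phiT; apply: contrapT => none.
have D0 w : mu (phi @^-1` [set u | fconnect f w u]) = 0%E.
  have mD : measurable (phi @^-1` [set u | fconnect f w u]).
    exact: fiber_measurable_preimage.
  have [|//|D1] := Terg.2 _ mD; last by case: none; exists w.
  by apply/seteqP; split => x /=; rewrite phiT -same_fconnect1_r.
have := sum_label_measure (probability_setT mu) mphi.
rewrite big1 => [/eqP|w _]; first by rewrite eq_sym oner_eq0.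
rewrite /label_measure -[fine _]/(fine (mu _)) (_ : mu _ = 0%E)//; apply/eqP.
have mw : measurable (phi @^-1` [set w]) by exact: mphi.
have mD : measurable (phi @^-1` [set u | fconnect f w u]).
  exact: fiber_measurable_preimage.
rewrite eq_le measure_ge0 andbT -(D0 w) le_measure ?inE// => x /= ->.
exact: connect0.
Qed.

(* The visits to B along one period form a finite factor on which T acts by
   rotation; by ergodicity it is carried by a single orbit, whose length is a
   power of p. *)
Lemma ergodic_prime_power (p n : nat) (B : set X) : prime p -> ~ cyclic_factor p ->
  measurable B -> iter (p ^ n) T @^-1` B = B -> mu B = 0%E \/ mu B = 1%E.
Proof.
move=> pp ncyc mB TB; set q := (p ^ n)%N in TB.
have q0 : (0 < q)%N by rewrite expn_gt0 prime_gt0.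
have [[[mT _] _] _] := Terg.
pose phi x := [ffun j : 'I_q => `[< B (iter j T x) >]].
have mphi : fiber_measurable phi.
  apply: (@fiber_measurable_ffun _ _ _ _
    (fun (j : 'I_q) x => `[< B (iter j T x) >])) => j.
  exact: (fiber_measurable_precomp (@measurable_fun_iter _ _ _ j mT)
    (fiber_measurable_set mB)).
have phiT x : phi (T x) = rotate_label (phi x).
  apply/ffunP => j; rewrite !ffunE -iterSr /=.
  (* Beyond the last coordinate the word returns to its start, by the invariance of [B] under the
     [q]-th iterate. *)
  have [e|ne] := eqVneq j.+1 q; last by rewrite modn_small// ltn_neqAle ne ltn_ord.
  by rewrite e modnn -iterS e; congr `[< _ >]; rewrite -[in RHS]TB.
have [w D1] := ergodic_orbit (@rotate_label_inj q) mphi phiT.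
set f := @rotate_label q in D1 phiT; set D := _ @^-1` _ in D1.
have mD : measurable D by exact: fiber_measurable_preimage.
(* An orbit of length 1 makes [phi] constant on [D], so coordinate 0 decides whether [B] is full or
   null. *)
have [/eqP|] := posnP (order f w).-1.
  have m0 := order_gt0 f w; rewrite -eqSS prednK// => /eqP m1.
  have phiD x : D x -> phi x = w.
    move=> Dx; rewrite -(iter_findex Dx).
    by have := findex_max Dx; rewrite m1 ltnS leqn0 => /eqP ->.
  pose o : 'I_q := Ordinal q0.
  have BD x : D x -> `[< B x >] = w o by move=> /phiD <-; rewrite ffunE.
  have [wo|wo] := boolP (w o); [right|left].
    apply/eqP; rewrite eq_le probability_le1//= -D1 le_measure ?inE//.
    by move=> x /BD; rewrite wo => /asboolP.
  have mCB : measurable (~` B) by exact: measurableC.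
  have : (mu (~` B) = 1)%E.
    apply/eqP; rewrite eq_le probability_le1//= -D1 le_measure ?inE//.
    by move=> x /BD; rewrite (negbTE wo) => /asboolP.
  rewrite probability_setC// => e.
  have /fineK <- : mu B \is a fin_num by rewrite fin_num_measure.
  move: e; rewrite -[X in (_ - X)%E = _]fineK ?fin_num_measure// -EFinB => -[].
  by move=> h; congr EFin; lra.
(* A longer orbit has a length divisible by [p], and the position along it would be a cyclic factor
   of order [p]. *)
move=> m1; case: ncyc; exists (fun x => findex f w (phi x)); split.
  exact: fiber_measurable_comp mphi.
apply: (ae_of_full mD D1) => x Dx /=.
have pm : (p %| order f w)%N.
  have := order_dvd_iter (@rotate_label_inj q) (iter_rotate_label w).
  case/(dvdn_pfactor _ _ pp) => -[|j] jn e; last by rewrite /f e expnS dvdn_mulr.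
  by move: m1; rewrite /f e.
rewrite phiT; set i := findex f w (phi x).
have ilt : (i < order f w)%N by exact: findex_max.
rewrite -(iter_findex Dx) -/i -[f _]/(iter i.+1 f w).
(* At the end of the orbit the position drops to 0, which is congruent to the length modulo [p]. *)
have [e|ne] := eqVneq i.+1 (order f w); last by rewrite findex_iter// ltn_neqAle ne.
rewrite e iter_order; last exact: rotate_label_inj.
have -> : findex f w w = 0%N by rewrite -[X in findex f w X]/(iter 0 f w) findex_iter.
by rewrite mod0n; apply/esym/eqP.
Qed.

End cyclic_factors.

(** * A sequence of distinct primes *)

Section euclid_odometer.

(** Euclid's construction: the next prime divides one more than the product of the preceding ones,
    so it is coprime to that product. *)
Fixpoint euclid_radix n : nat :=
  if n is n'.+1 then (euclid_radix n' * pdiv (euclid_radix n').+1)%N else 1%N.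

Definition euclid_prime n : nat := pdiv (euclid_radix n).+1.

Lemma radix_euclid n : radix euclid_prime n = euclid_radix n.
Proof.
by elim: n => [|n IH]; [rewrite /radix big_ord0|rewrite radixS IH].
Qed.

Lemma euclid_radix_gt0 n : (0 < euclid_radix n)%N.
Proof. by elim: n => //= n IH; rewrite muln_gt0 IH pdiv_gt0. Qed.

Lemma euclid_prime_prime n : prime (euclid_prime n).
Proof. by rewrite pdiv_prime// ltnS euclid_radix_gt0. Qed.

Lemma coprime_euclid n : coprime (euclid_radix n) (euclid_prime n).
Proof.
rewrite coprime_sym prime_coprime ?euclid_prime_prime//; apply/negP => dvd.
have := pdiv_dvd (euclid_radix n).+1; rewrite -/(euclid_prime n) -addn1 dvdn_addr//.
by rewrite dvdn1 => /eqP e; have := euclid_prime_prime n; rewrite e.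
Qed.

End euclid_odometer.

(** * From prime periods to an odometer factor *)

Section odometer_factor.
Context d (X : measurableType d) (R : realType) (mu : probability X R).
Variable T : X -> X.
Hypothesis Terg : ergodic mu T.

(** Glues the first [n] cyclic factors into one modulo the product of their primes; the final
    reduction makes the representative canonical. *)
Fixpoint residue (c : nat -> X -> nat) n (x : X) : nat :=
  if n is n'.+1 then
    (chinese (euclid_radix n') (euclid_prime n') (residue c n' x) (c n' x)
       %% euclid_radix n)%N
  else 0%N.

Definition residue_digits (c : nat -> X -> nat) (x : X) : odometer euclid_prime :=
  fun n => inZp (residue c n.+1 x %/ euclid_radix n).

Section residue.
Variable c : nat -> X -> nat.
Hypothesis mc : forall n, fiber_measurable (c n).

Let k2 n : (2 <= euclid_prime n)%N.
Proof. exact/prime_gt1/euclid_prime_prime. Qed.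

Lemma fiber_measurable_residue n : fiber_measurable (residue c n).
Proof.
elim: n => [|n IH]; first exact: (fiber_measurable_comp (fun=> 0%N) (@mc 0%N)).
exact: (fiber_measurable_comp
  (fun u => chinese (euclid_radix n) (euclid_prime n) u.1 u.2 %% euclid_radix n.+1)%N
  (fiber_measurable_pair IH (@mc n))).
Qed.

Lemma residue_lt n x : (residue c n x < euclid_radix n)%N.
Proof. by case: n => //= n; rewrite ltn_mod (euclid_radix_gt0 n.+1). Qed.

Lemma residue_modl n x : residue c n.+1 x = residue c n x %[mod euclid_radix n].
Proof. by rewrite /= modn_dvdm ?dvdn_mulr// chinese_modl// coprime_euclid. Qed.

Lemma residue_modr n x : residue c n.+1 x = c n x %[mod euclid_prime n].
Proof. by rewrite /= modn_dvdm ?dvdn_mull// chinese_modr// coprime_euclid. Qed.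

(** Both sides agree modulo [euclid_radix n] and modulo [euclid_prime n], which are coprime. *)
Lemma residue_succ x : (forall n, c n (T x) = (c n x).+1 %[mod euclid_prime n]) ->
  forall n, residue c n (T x) = ((residue c n x).+1 %% euclid_radix n)%N.
Proof.
move=> cT; elim=> [|n IH]; first by rewrite modn1.
rewrite -[LHS](modn_small (residue_lt _ _)); apply/eqP.
rewrite [X in (_ == _ %[mod X])%N]/= chinese_remainder ?coprime_euclid//.
apply/andP; split; apply/eqP.
  by rewrite residue_modl IH modn_mod; apply/esym/modn_congr; exact: residue_modl.
by rewrite residue_modr cT; apply/esym/modn_congr; exact: residue_modr.
Qed.

Lemma odometer_value_residue n x :
  odometer_value n (residue_digits c x) = residue c n x.
Proof.
elim: n => [|n IH]; first by rewrite /odometer_value big_ord0.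
rewrite odometer_valueS IH -(modn_small (residue_lt n x)) -residue_modl.
rewrite radix_euclid [in RHS](divn_eq (residue c n.+1 x) (euclid_radix n)) addnC.
congr (_ * _ + _)%N; rewrite /residue_digits /= Zp_cast// modn_small//.
by rewrite ltn_divLR ?euclid_radix_gt0// [X in (_ < X)%N]mulnC; exact: (residue_lt n.+1).
Qed.

End residue.

Lemma prime_cyclic_factors_odometer :
  (forall p, prime p -> cyclic_factor mu T p) -> has_odometer_factor mu T.
Proof.
move=> /(_ _ (euclid_prime_prime _)) cyc.
have k2 n : (2 <= euclid_prime n)%N by exact/prime_gt1/euclid_prime_prime.
have [c cP] := choice cyc.
have mc n : fiber_measurable (c n) by exact: (cP n).1.
have mh : measurable_fun setT (residue_digits c).
  apply: measurable_fun_odometer => // n.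
  rewrite (_ : (fun x => _) = residue c n); first exact: fiber_measurable_residue.
  by apply/funext => x; rewrite odometer_value_residue.
(* The measure on the odometer is defined as the image of [mu], so it is preserved by construction;
   its uniformity comes from [cyclic_factor_uniform]. *)
have [m' m'E] := exists_pushforward mu mh.
have m'1 : m' setT = 1%E by rewrite m'E preimage_setT; exact: probability_setT.
have [nu nuE] := exists_probability m'1.
have cT : {ae mu, forall x, forall n, c n (T x) = (c n x).+1 %[mod euclid_prime n]}.
  by apply: ae_foralln => n; exact: (cP n).2.
exists euclid_prime, nu; split.
  apply: uniform_values_is_odometer => // n v; rewrite radix_euclid => vlt.
  rewrite -[LHS]/(nu _) nuE m'E.
  rewrite -(cyclic_factor_uniform Terg (euclid_radix_gt0 n)
    (@fiber_measurable_residue c mc n) (residue_lt c n) _ vlt); last first.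
    by apply: filterS cT => x /residue_succ.
  congr (mu _); apply/seteqP; split => x /=; by rewrite odometer_value_residue.
exists (residue_digits c); split.
  split => // B mB; rewrite -[RHS]/(nu _) nuE m'E//.
apply: filterS cT => x /residue_succ cTx; apply: odometer_value_inj => // n.
by rewrite odometer_value_map// !odometer_value_residue cTx radix_euclid.
Qed.

End odometer_factor.

(** * Ergodicity of the product *)

Lemma measurable_product_map d d' (X : measurableType d) (Y : measurableType d')
    (T : X -> X) (S : Y -> Y) : measurable_fun setT T -> measurable_fun setT S ->
  measurable_fun setT (product_map T S).
Proof.
move=> mT mS; apply/measurable_fun_pairP; split.
  exact: (measurableT_comp mT measurable_fst).
exact: (measurableT_comp mS measurable_snd).
Qed.

Section product_map.
Context d d' (X : measurableType d) (Y : measurableType d') (R : realType).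
Variables (mu : probability X R) (nu : probability Y R).
Variables (T : X -> X) (S : Y -> Y).

Lemma product_map_preserving : measure_preserving mu mu T ->
  measure_preserving nu nu S ->
  measure_preserving (mu \x nu)%E (mu \x nu)%E (product_map T S).
Proof.
move=> [mT T_mu] [mS S_nu]; have mTS := measurable_product_map mT mS.
split=> // E mE.
have [m' m'E] := exists_pushforward (mu \x nu)%E mTS.
rewrite -m'E; apply/esym; apply: product_measure_unique => // A B mA mB.
rewrite m'E (_ : _ @^-1` _ = (T @^-1` A) `*` (S @^-1` B))//.
have mA' : measurable (T @^-1` A) by rewrite -[_ @^-1` _]setTI; exact: mT.
have mB' : measurable (S @^-1` B) by rewrite -[_ @^-1` _]setTI; exact: mS.
by rewrite [LHS]product_measure1E// T_mu// S_nu.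
Qed.

Lemma product_map_invertible : invertible_measure_preserving mu T ->
  invertible_measure_preserving nu S ->
  invertible_measure_preserving (mu \x nu)%E (product_map T S).
Proof.
move=> [T_mu [T' [TK T'K mT']]] [S_nu [S' [SK S'K mS']]]; split.
  exact: (product_map_preserving T_mu S_nu).
exists (product_map T' S'); split.
- by move=> [x y]; rewrite /product_map/= TK SK.
- by move=> [x y]; rewrite /product_map/= T'K S'K.
- exact: measurable_product_map.
Qed.

End product_map.

(** The constant is the essential infimum of [g]. It is given explicitly so that functions with the
    same distribution visibly have the same constant. *)
Lemma ae_constant d (X : measurableType d) (R : realType) (mu : probability X R)
    (g : X -> R) :
  measurable_fun setT g -> (forall x, 0 <= g x <= 1) ->
  (forall t, mu [set x | g x < t] = 0%E \/ mu [set x | g x < t] = 1%E) ->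
  {ae mu, forall x, g x = sup [set t | mu [set x | g x < t] = 0%E]}.
Proof.
move=> mg g01 dicho; set S := [set t | _]; set c := sup S.
have mlt t : measurable [set x | g x < t].
  rewrite (_ : mkset _ = g @^-1` [set` `]-oo, t[]); last first.
    by apply/seteqP; split => x /=; rewrite in_itv.
  by rewrite -[_ @^-1` _]setTI; exact: mg.
have S0 : S 0.
  rewrite /S/= (_ : mkset _ = set0) ?measure0//; apply/seteqP; split => // x /=.
  by rewrite ltNge; case/andP: (g01 x) => ->.
have S2 : ubound S 2.
  move=> t St; rewrite leNgt; apply/negP => t2.
  suff : mu [set x | g x < t] = 1%E by rewrite St => /eqP; rewrite eqe eq_sym oner_eq0.
  rewrite (_ : mkset _ = setT) ?probability_setT//; apply/seteqP; split => // x _ /=.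
  by case/andP: (g01 x) => _ /le_lt_trans; apply; lra.
have S_sup : has_sup S by split; [exists 0|exists 2].
have Sdown s t : S t -> s <= t -> S s.
  move=> St st; rewrite /S/=; apply/eqP; rewrite eq_le measure_ge0 andbT -St.
  by rewrite le_measure ?inE// => x /= /lt_le_trans; apply.
have below : {ae mu, forall x, forall n : nat, c - n.+1%:R^-1 <= g x}.
  apply: ae_foralln => n; exists [set x | g x < c - n.+1%:R^-1]; split => //.
    have n0 : 0 < n.+1%:R^-1 :> R by rewrite invr_gt0 ltr0n.
    by have [t St ct] := sup_adherent n0 S_sup; exact: (Sdown _ _ St (ltW ct)).
  by move=> x /= /negP; rewrite -ltNge.
have above : {ae mu, forall x, forall n : nat, g x < c + n.+1%:R^-1}.
  apply: ae_foralln => n.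
  have n0 : 0 < n.+1%:R^-1 :> R by rewrite invr_gt0 ltr0n.
  have [Sc|D1] := dicho (c + n.+1%:R^-1); last exact: ae_of_full (mlt _) D1 _.
  have : c + n.+1%:R^-1 <= c by apply: sup_ubound => //; exact: S_sup.2.
  by rewrite gerDl leNgt n0.
apply: filterS2 below above => x lo up; apply/eqP; rewrite eq_le; apply/andP; split.
  apply/ler_addgt0Pr => e e0; have [n ne] := @ltr_add_invr R 0 e e0.
  by rewrite (ltW (lt_le_trans (up n) _))// lerD2l ltW//; rewrite add0r in ne.
apply/ler_addgt0Pr => e e0; have [n ne] := @ltr_add_invr R 0 e e0.
by rewrite add0r in ne; rewrite -lerBlDr (le_trans _ (lo n))// lerD2l lerN2 ltW.
Qed.

Section product_ergodic.
Context d (X : measurableType d) (R : realType) (mu : probability X R).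
Variables (T : X -> X) (k : nat -> nat) (nu : probability (odometer k) R).
Hypotheses (Terg : ergodic mu T) (k2 : forall n, (2 <= k n)%N)
  (unif : uniform_values nu)
  (powers : forall n B, measurable B -> iter (radix k n) T @^-1` B = B ->
     mu B = 0%E \/ mu B = 1%E).
Notation S := (@odometer_map k).

Section invariant_set.
Variable A : set (X * odometer k).
Hypotheses (mA : measurable A) (TA : product_map T S @^-1` A = A).

Let cyl n v : set (odometer k) := [set y | odometer_value n y = v].

Let mcyl n v : measurable (cyl n v).
Proof. exact: fiber_measurable_odometer_value. Qed.

Let msec x : measurable (xsection A x).
Proof. exact: measurable_xsection. Qed.

Definition section_mass n v x : R := fine (nu (xsection A x `&` cyl n v)).

Lemma section_massE n v x :
  nu (xsection A x `&` cyl n v) = (section_mass n v x)%:E.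
Proof. by rewrite fineK// fin_num_measure//; exact: measurableI. Qed.

Lemma measurable_section_mass n v : measurable_fun setT (section_mass n v).
Proof.
have mAC : measurable (A `&` setT `*` cyl n v).
  by apply: measurableI => //; exact: measurableX.
rewrite (_ : section_mass n v =
    fine \o (nu \o xsection (A `&` setT `*` cyl n v))); last first.
  apply/funext => x; congr (fine (nu _)); apply/seteqP; split => y.
    by move=> [/set_mem Ay yv]; apply/mem_set; split.
  by move=> /set_mem[Ay [_ yv]]; split => //; apply/mem_set.
by apply: measurableT_comp => //; exact: measurable_fun_xsection.
Qed.

Lemma section_mass_01 n v x : 0 <= section_mass n v x <= 1.
Proof.
have mI : measurable (xsection A x `&` cyl n v) by exact: measurableI.
by rewrite -!lee_fin -section_massE measure_ge0/= probability_le1.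
Qed.

(** Invariance of [A] makes the section over [x] the preimage under the odometer map of the section
    over [T x], and this map preserves [nu]. *)
Lemma section_mass_succ n v x : (v < radix k n)%N ->
  section_mass n (v.+1 %% radix k n)%N (T x) = section_mass n v x.
Proof.
move=> vlt; congr fine.
have mI : measurable (xsection A (T x) `&` cyl n (v.+1 %% radix k n)%N).
  exact: measurableI.
rewrite -(odometer_map_preserving k2 unif).2//; congr (nu _).
apply/seteqP; split => y; rewrite /cyl/= odometer_value_map//.
  move=> [/set_mem Ay]; rewrite -addn1 -[v.+1]addn1 => /eqP.
  rewrite eqn_modDr !modn_small ?odometer_value_lt// => /eqP yv; split => //.
  by apply/mem_set; rewrite -TA.
move=> [/set_mem Ay ->]; split => //; apply/mem_set.
by move: Ay; rewrite -[in X in X -> _]TA.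
Qed.

Lemma section_mass_iter n v x j : (v < radix k n)%N ->
  section_mass n ((v + j) %% radix k n)%N (iter j T x) = section_mass n v x.
Proof.
move=> vlt; elim: j => [|j IH]; first by rewrite addn0 modn_small.
have vj : ((v + j) %% radix k n < radix k n)%N by rewrite ltn_mod radix_gt0.
by rewrite -IH -(section_mass_succ _ vj) -[in RHS]addn1 modnDml addn1 addnS.
Qed.

Let C n v := sup [set t | mu [set x | section_mass n v x < t] = 0%E].

(** After [radix k n] steps the cylinder is back at itself, so the sublevel sets are invariant under
    that power of [T]. *)
Lemma section_mass_ae n v : (v < radix k n)%N ->
  {ae mu, forall x, section_mass n v x = C n v}.
Proof.
move=> vlt; apply: ae_constant => [||t]; first exact: measurable_section_mass.
  exact: section_mass_01.
apply: (powers (n := n)).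
  rewrite (_ : mkset _ = section_mass n v @^-1` [set` `]-oo, t[]); last first.
    by apply/seteqP; split => x /=; rewrite in_itv.
  by rewrite -[_ @^-1` _]setTI; exact: measurable_section_mass.
have e x : section_mass n v (iter (radix k n) T x) = section_mass n v x.
  by rewrite -[RHS](section_mass_iter x (radix k n) vlt) modnDr modn_small.
by apply/seteqP; split => x /=; rewrite e.
Qed.

(** Consecutive masses differ by composition with [T], so they have the same distribution, hence the
    same constant. *)
Lemma section_mass_cst n v : (v < radix k n)%N -> C n v = C n 0.
Proof.
elim: v => // v IH vlt; rewrite -IH ?(ltnW vlt)//; congr sup.
have [[[mT T_mu] _] _] := Terg.
have mlt t : measurable [set x | section_mass n v.+1 x < t].
  rewrite (_ : mkset _ = section_mass n v.+1 @^-1` [set` `]-oo, t[]); last first.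
    by apply/seteqP; split => x /=; rewrite in_itv.
  by rewrite -[_ @^-1` _]setTI; exact: measurable_section_mass.
have e t : T @^-1` [set x | section_mass n v.+1 x < t] =
    [set x | section_mass n v x < t].
  have succ x : section_mass n v.+1 (T x) = section_mass n v x.
    by rewrite -(section_mass_succ x (ltnW vlt)) modn_small.
  by apply/seteqP; split => x /=; rewrite succ.
by apply/seteqP; split => t /=; rewrite -(T_mu _ (mlt t)) e.
Qed.

Lemma section_mass_sum n x :
  \sum_(v < radix k n) section_mass n v x = fine (nu (xsection A x)).
Proof.
pose label y : 'I_(radix k n) := Ordinal (odometer_value_lt k2 n y).
have labelE (v : 'I_(radix k n)) : label @^-1` [set v] = cyl n v.
  by apply/seteqP; split => y /=; [move=> <-|move=> yv; exact: val_inj].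
have mlabel : fiber_measurable label by move=> v; rewrite labelE.
have : nu (label @^-1` [set i | predT i] `&` xsection A x) =
    (\sum_(v | predT v) nu (label @^-1` [set v] `&` xsection A x))%E.
  exact: (@measure_preimage_sum _ _ _ (mrestr nu (msec x)) _ _ predT mlabel).
rewrite (_ : label @^-1` _ = setT); last by apply/seteqP; split.
rewrite setTI => ->; rewrite (eq_bigr (fun v : 'I_(radix k n) =>
  (section_mass n v x)%:E)); first by rewrite sumEFin.
by move=> v _; rewrite -section_massE labelE setIC.
Qed.

(* Almost every section is independent of all cylinders, hence of itself. *)
Lemma section_null_or_full : {ae mu, forall x,
  nu (xsection A x) = 0%E \/ nu (xsection A x) = 1%E}.
Proof.
have H : {ae mu, forall x, forall n v, (v < radix k n)%N -> section_mass n v x = C n 0}.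
  apply: ae_foralln => n; apply: ae_foralln => v.
  have [vlt|vge] := ltnP v (radix k n); last exact: aeW.
  by apply: filterS (section_mass_ae vlt) => x -> _; exact: section_mass_cst.
apply: filterS H => x hx.
pose a := fine (nu (xsection A x)).
have aE : nu (xsection A x) = a%:E by rewrite fineK// fin_num_measure.
have a0 : 0 <= a by exact: fine_ge0.
(* Both sides are measures in [B], and the left one is finite, so it suffices to compare them on
   cylinders. *)
have indep B : measurable B -> nu (B `&` xsection A x) = (a%:E * nu B)%E.
  move=> mB; have := @odometer_measure_unique k k2 R
    (mrestr nu (msec x)) (mscale (NngNum a0) nu).
  apply => //.
    rewrite /mrestr -ge0_fin_numE// fin_num_measure//; exact: measurableI.
  move=> n v; rewrite -[LHS]/(nu (_ `&` _)) -[RHS]/(a%:E * nu _)%E setIC.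
  have [vlt|vge] := ltnP v (radix k n); last first.
    rewrite (_ : mkset _ = set0) ?setI0 ?measure0 ?mule0//.
    apply/seteqP; split => // y /= yv.
    by have := odometer_value_lt k2 n y; rewrite yv ltnNge vge.
  rewrite -[X in nu (_ `&` X)]/(cyl n v) section_massE.
  rewrite -[X in (_ * X)%E]/(_ nu _) unif// -EFinM; congr EFin.
  have P0 : (radix k n)%:R != 0 :> R by rewrite pnatr_eq0 -lt0n radix_gt0.
  rewrite hx// /a -(section_mass_sum n); apply: (mulIf P0); rewrite mulfVK//.
  rewrite (eq_bigr (fun=> C n 0)); last by move=> i _; rewrite hx.
  by rewrite sumr_const card_ord mulr_natr.
(* Taking for [B] the section itself gives [a = a * a]. *)
have := indep _ (msec x); rewrite setIid aE -EFinM => -[] /eqP.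
rewrite -subr_eq0 -[X in X - _]mulr1 -mulrBr mulf_eq0 subr_eq0 => /orP[/eqP ->|/eqP <-].
  by left.
by right.
Qed.

(** The cylinder of length 0 and value 0 is the whole odometer, so almost every section has measure
    [C 0 0]; a single good point shows that this is 0 or 1. *)
Lemma invariant_null_or_full : (mu \x nu)%E A = 0%E \/ (mu \x nu)%E A = 1%E.
Proof.
have sec00 x : nu (xsection A x) = (section_mass 0 0 x)%:E.
  rewrite -section_massE; congr (nu _); apply/seteqP; split => y; last by case.
  by move=> Ay; split => //; rewrite /cyl/= /odometer_value big_ord0.
have r0 : (0 < radix k 0)%N by exact: radix_gt0.
have lamE : (mu \x nu)%E A = (C 0 0)%:E.
  rewrite /product_measure1 (ae_eq_integral (cst (C 0 0)%:E))//.
  - by rewrite integral_cst//= -[X in (_ * X)%E]/(mu _) probability_setT mule1.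
  - exact: measurable_fun_xsection.
  - by apply: filterS (section_mass_ae r0) => x e _ /=; rewrite sec00 e.
have [x [xC]] := ae_exists (filterI (section_mass_ae r0) section_null_or_full).
by rewrite sec00 xC lamE.
Qed.

End invariant_set.

Lemma product_ergodic : ergodic (mu \x nu)%E (product_map T S).
Proof.
split; last by move=> A mA TA; exact: invariant_null_or_full.
apply: product_map_invertible; first exact: Terg.1.
split; first exact: odometer_map_preserving.
exists (@odometer_inv k); split.
- exact: odometer_mapK.
- exact: odometer_invK.
- exact: measurable_odometer_inv.
Qed.

End product_ergodic.

(** * Entropy of the product *)

Lemma iter_product_map d d' (X : measurableType d) (Y : measurableType d')
    (T : X -> X) (S : Y -> Y) j z :
  iter j (product_map T S) z = (iter j T z.1, iter j S z.2).
Proof. by elim: j => [|j IH]; [case: z|rewrite !iterS IH]. Qed.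

(** * Approximation by sets that depend on finitely many digits *)

Section level_sets.
Context d (X : measurableType d) (k : nat -> nat).
Hypothesis k2 : forall n, (2 <= k n)%N.
Notation Z := (X * odometer k)%type.

Definition level_set n (E : set Z) : Prop :=
  exists G : X -> nat -> bool, (forall v, fiber_measurable (G ^~ v)) /\
    E = [set z | G z.1 (odometer_value n z.2)].

Lemma level_set_raise m n E : (m <= n)%N -> level_set m E -> level_set n E.
Proof.
move=> mn [G [mG ->]]; exists (fun x v => G x (v %% radix k m)%N); split => //.
by apply/seteqP; split => z /=; rewrite (odometer_value_mod k2 z.2 mn).
Qed.

Lemma level_setD n E F : level_set n E -> level_set n F -> level_set n (E `\` F).
Proof.
move=> [G [mG ->]] [H [mH ->]]; exists (fun x v => G x v && ~~ H x v); split.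
  move=> v; exact: (fiber_measurable_comp (fun u => u.1 && ~~ u.2)
    (fiber_measurable_pair (@mG v) (@mH v))).
by apply/seteqP; split => z /=; [move=> [-> /negP ->]|move/andP => [-> /negP]].
Qed.

Lemma level_setT n : level_set n setT.
Proof.
exists (fun _ _ => true); split; last by apply/seteqP; split.
by move=> v; exact: (fiber_measurable_comp (fun=> true) (fiber_measurable_set measurableT)).
Qed.

Lemma level_setI n E F : level_set n E -> level_set n F -> level_set n (E `&` F).
Proof. by move=> nE nF; rewrite -setDD; do 2 apply: level_setD => //. Qed.

Lemma measurable_level_set n E : level_set n E -> measurable E.
Proof.
move=> [G [mG ->]]; rewrite (_ : mkset _ = \bigcup_v
    ((G ^~ v @^-1` [set true]) `*` (@odometer_value k n @^-1` [set v]))).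
  apply: bigcupT_measurable => v; apply: measurableX; first exact: mG.
  exact: fiber_measurable_odometer_value.
apply/seteqP; split => [z Gz|z [v _ [/= Gz zv]]]; last by rewrite zv.
by exists (odometer_value n z.2).
Qed.

Definition level_sets : set (set Z) := [set E | exists n, level_set n E].

Lemma level_sets_setI : setI_closed level_sets.
Proof.
move=> E F [m mE] [n nF]; exists (maxn m n); apply: level_setI.
  by apply: level_set_raise mE; exact: leq_maxl.
by apply: level_set_raise nF; exact: leq_maxr.
Qed.

(* The identity is measurable from the sigma-algebra generated by the level
   sets because its two components are. *)
Lemma measurable_level_sets : @measurable _ Z `<=` <<s level_sets >>.
Proof.
move=> E mE; have : measurable_fun setT (fun z : g_sigma_algebraType level_sets => z : Z).
  apply/measurable_fun_pairP; split.
    move=> _ A mA; rewrite setTI; apply: sub_sigma_algebra; exists 0%N.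
    exists (fun x _ => `[< A x >]); split; first by move=> _; exact: fiber_measurable_set.
    by apply/seteqP; split => z /=; [move/asboolP|move/asboolP].
  apply: measurable_fun_odometer => // n v; apply: sub_sigma_algebra; exists n.
  exists (fun _ w => w == v); split.
    move=> w; exact: (fiber_measurable_comp (fun=> w == v)
      (fiber_measurable_set measurableT)).
  by apply/seteqP; split => z /=; [move/eqP|move/eqP].
by move=> /(_ measurableT E mE); rewrite setTI.
Qed.

Variables (R : realType) (m : {measure set Z -> \bar R}).
Hypothesis m1 : m setT = 1%E.

Definition symdiff (E F : set Z) := (E `\` F) `|` (F `\` E).

Lemma measurable_symdiff E F : measurable E -> measurable F -> measurable (symdiff E F).
Proof. by move=> mE mF; apply: measurableU; exact: measurableD. Qed.

Definition approximable (E : set Z) := measurable E /\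
  forall e : R, 0 < e -> exists n F, level_set n F /\ (m (symdiff E F) < e%:E)%E.

Lemma measure_symdiff_lt E F E1 F1 E2 F2 (e : R) :
  measurable (symdiff E F) -> measurable (symdiff E1 F1) -> measurable (symdiff E2 F2) ->
  symdiff E F `<=` symdiff E1 F1 `|` symdiff E2 F2 ->
  (m (symdiff E1 F1) < (e / 2)%:E)%E -> (m (symdiff E2 F2) < (e / 2)%:E)%E ->
  (m (symdiff E F) < e%:E)%E.
Proof.
move=> mD mD1 mD2 sub lt1 lt2.
rewrite (@le_lt_trans _ _ (m (symdiff E1 F1) + m (symdiff E2 F2))%E)//.
  rewrite (le_trans _ (measureU2 _ mD1 mD2))// le_measure ?inE//.
  exact: measurableU.
by rewrite [e in ltRHS](splitr e) EFinD lteD.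
Qed.

(** The approximable sets form a lambda-system that contains the level sets, and these are a
    generating pi-system. *)
Lemma measurable_approximable : @measurable _ Z `<=` approximable.
Proof.
move=> E /measurable_level_sets; apply: lambda_system_subset => //.
- exact: level_sets_setI.
- have approxT : approximable setT.
    split=> // e e0; exists 0%N, setT; split; first exact: level_setT.
    by rewrite /symdiff setDT setU0 measure0.
  split => //.
  + move=> A B BA [mA hA] [mB hB]; split=> [|e e0]; first exact: measurableD.
    have e20 : 0 < e / 2 by rewrite divr_gt0.
    have [n [F [nF AF]]] := hA _ e20; have [l [G [lG BG]]] := hB _ e20.
    have {}nF := level_set_raise (leq_maxl n l) nF.
    have {}lG := level_set_raise (leq_maxr n l) lG.
    exists (maxn n l), (F `\` G); split; first exact: level_setD.
    have mF := measurable_level_set nF; have mG := measurable_level_set lG.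
    apply: measure_symdiff_lt AF BG; try apply: measurable_symdiff => //;
      try exact: measurableD.
    rewrite /symdiff => z /=.
    by have := EM (A z); have := EM (B z); have := EM (F z); have := EM (G z); tauto.
  (* Continuity of the measure gives a term within [e / 2] of the increasing union, and that term is
     itself approximated within [e / 2]. *)
  + move=> F ndF hF.
    have mF i : measurable (F i) by exact: (hF i).1.
    have mU : measurable (\bigcup_i F i) by exact: bigcupT_measurable.
    split=> // e e0; have e20 : 0 < e / 2 by rewrite divr_gt0.
    have mfin A : measurable A -> m A \is a fin_num by exact: fin_num_label.
    have : (m (F i) @[i --> \oo] --> m (\bigcup_i F i))%E.
      exact: nondecreasing_cvg_mu.
    rewrite -(fineK (mfin _ mU)) => /fine_cvgP[_] /cvgrPdist_lt /(_ _ e20) [i _].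
    move=> /(_ i (leqnn i)) Fi; have [n [G [nG FG]]] := (hF i).2 _ e20.
    exists n, G; split=> //; have mG := measurable_level_set nG.
    apply: (measure_symdiff_lt (E1 := \bigcup_i F i) (F1 := F i)) _ FG.
    * exact: measurable_symdiff.
    * exact: measurable_symdiff.
    * exact: measurable_symdiff.
    * rewrite /symdiff => z /=.
      by have := EM (F i z); tauto.
    * have FU : F i `<=` \bigcup_i F i by exact: bigcup_sup.
      have -> : symdiff (\bigcup_i F i) (F i) = \bigcup_i F i `\` F i.
        by rewrite /symdiff (_ : F i `\` _ = set0) ?setU0//; rewrite setD_eq0.
      rewrite measureD//=; last by rewrite -ge0_fin_numE// mfin.
      rewrite (setIidr FU) -(fineK (mfin _ mU)) -(fineK (mfin _ (mF i))) -EFinB lte_fin.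
      by rewrite (le_lt_trans (ler_norm _)).
- move=> F [n nF]; split=> [|e e0]; first exact: measurable_level_set nF.
  by exists n, F; split => //; rewrite /symdiff setDv setU0 measure0.
Qed.

End level_sets.

Section product_entropy.
Context d (X : measurableType d) (R : realType) (mu : probability X R).
Variables (T : X -> X) (k : nat -> nat) (nu : probability (odometer k) R).
Hypotheses (T_mu : measure_preserving mu mu T) (k2 : forall n, (2 <= k n)%N)
  (unif : uniform_values nu).
Notation S := (@odometer_map k).
Notation Z := (X * odometer k)%type.
Notation TS := (product_map T S).

Let lam : {measure set Z -> \bar R} := (mu \x nu)%E.

Let lam1 : lam setT = 1%E.
Proof.
rewrite -setXTT [LHS]product_measure1E//.
by rewrite -[X in (X * _)%E]/(mu _) -[X in (_ * X)%E]/(nu _) !probability_setT mule1.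
Qed.

Let TS_lam : measure_preserving lam lam TS.
Proof. exact: (product_map_preserving T_mu (odometer_map_preserving k2 unif)). Qed.

Let fst_lam : measure_preserving lam mu (@fst X (odometer k)).
Proof.
split; first exact: measurable_fst.
move=> B mB; rewrite (_ : _ @^-1` _ = B `*` setT); last first.
  by apply/seteqP; split => z /=; [split|case].
by rewrite [LHS]product_measure1E// -[X in (_ * X)%E]/(nu _) probability_setT mule1.
Qed.

(** The labels are approximated one by one, so the [G i] may overlap; the number of digits is the
    maximum over the labels. *)
Lemma approximate_label N (xi : Z -> 'I_N) (e : R) : fiber_measurable xi -> 0 < e ->
  exists n (G : 'I_N -> X -> nat -> bool),
    (forall i v, fiber_measurable (G i ^~ v)) /\
    forall i, (lam [set z | (xi z == i) != G i z.1 (odometer_value n z.2)] < e%:E)%E.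
Proof.
move=> mxi e0.
have approx i : exists nF : nat * set Z, level_set nF.1 nF.2 /\
    (lam (symdiff (xi @^-1` [set i]) nF.2) < e%:E)%E.
  have [_ /(_ e e0) [n [F nF]]] := measurable_approximable k2 lam1 (mxi i).
  by exists (n, F).
have [f fP] := choice approx.
pose n := (\max_(i < N) (f i).1)%N.
have raise i : exists G : X -> nat -> bool, (forall v, fiber_measurable (G ^~ v)) /\
    (f i).2 = [set z | G z.1 (odometer_value n z.2)].
  by apply: level_set_raise (fP i).1 => //; exact: (leq_bigmax (F := fun i => (f i).1)).
have [G GP] := choice raise; exists n, G; split=> [i v|i]; first exact: (GP i).1.
rewrite (_ : mkset _ = symdiff (xi @^-1` [set i]) (f i).2); first exact: (fP i).2.
rewrite (GP i).2 /symdiff; apply/seteqP; split => z /=.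
  case: (G i z.1 _); first by rewrite eqb_id => /eqP zi; right.
  by rewrite eqbF_neg negbK => /eqP; left.
move=> [[-> /negP/negbTE ->]|[-> /eqP/negbTE ->]]//.
by rewrite eqxx.
Qed.

(* xi is decoded from an approximating label zeta and an error label eta; the
   label zeta is decoded from a label alpha of X and from the residue gamma of
   the second coordinate, whose evolution is deterministic. *)
Lemma entropy_product_le :
  (entropy lam TS <= entropy mu T + 2%:E)%E.
Proof.
apply: entropy_le_addr => //; first exact: probability_setT.
move=> N xi mxi; pose W := {ffun 'I_N -> bool}.
(* With this [e], the bound [1 + 2 * e * #|W|] on the entropy of the error label equals 2. *)
pose e : R := (2 * #|W|%:R)^-1.
have W0 : 0 < #|W|%:R :> R by rewrite ltr0n; apply/card_gt0P; exists [ffun=> true].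
have e0 : 0 < e by rewrite invr_gt0 mulr_gt0.
have [n [G [mG GE]]] := approximate_label mxi (exprn_gt0 2 e0).
have P0 := radix_gt0 k2 n.
pose residue_of v : 'I_(radix k n) := Ordinal (ltn_pmod v P0).
pose alpha x : {ffun 'I_(radix k n) -> W} := [ffun a => [ffun i => G i x (val a)]].
pose gamma (y : odometer k) := residue_of (odometer_value n y).
pose zeta (z : Z) : W := [ffun i => G i z.1 (odometer_value n z.2)].
pose eta (z : Z) : W := [ffun i => (xi z == i) != G i z.1 (odometer_value n z.2)].
have mcode i : fiber_measurable (fun z : Z => G i z.1 (odometer_value n z.2)).
  move=> b; rewrite (_ : _ @^-1` _ = if b then
    [set z | G i z.1 (odometer_value n z.2)] else
    ~` [set z | G i z.1 (odometer_value n z.2)]).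
    have mGi : measurable [set z : Z | G i z.1 (odometer_value n z.2)].
      by apply: (measurable_level_set (n := n)); exists (G i).
    by case: b => //; exact: measurableC.
  by case: b; apply/seteqP; split => z //=; [move=> ->|move/negP/negbTE].
have malpha : fiber_measurable alpha.
  apply: (@fiber_measurable_ffun _ _ _ _
    (fun a x => [ffun i => G i x (val a)] : W)) => a.
  exact: (@fiber_measurable_ffun _ _ _ _ (fun i x => G i x (val a))).
have mgamma : fiber_measurable (gamma \o snd : Z -> _).
  have := fiber_measurable_precomp measurable_snd
    (fiber_measurable_comp residue_of (@fiber_measurable_odometer_value k n)).
  exact.
have mzeta : fiber_measurable zeta.
  exact: (@fiber_measurable_ffun _ _ _ _
    (fun i z => G i z.1 (odometer_value n z.2))).
have meta : fiber_measurable eta.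
  apply: (@fiber_measurable_ffun _ _ _ _
    (fun i z => (xi z == i) != G i z.1 (odometer_value n z.2))) => i.
  exact: (fiber_measurable_comp (fun u => (u.1 == i) != u.2)
    (fiber_measurable_pair mxi (mcode i))).
exists {ffun 'I_(radix k n) -> W}, alpha, (partition_entropy lam (gamma \o snd)).
split=> // j.
have eta_le : partition_entropy lam eta <= 2.
  (* An error code that is not constantly false is true at some [i], so its fiber lies where the
     approximation of label [i] fails. *)
  have eta_small w : w != [ffun=> false] -> label_measure lam eta w <= e ^+ 2.
    move=> w0; have [i wi] : exists i, w i.
      apply: contrapT => none; move/eqP: w0; apply; apply/ffunP => i.
      by rewrite ffunE; apply/negbTE/negP => wi; apply: none; exists i.
    rewrite -lee_fin -label_measureE// (le_trans _ (ltW (GE i)))// le_measure ?inE//.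
      rewrite (_ : mkset _ = (fun z => eta z i) @^-1` [set true]); last first.
        by apply/seteqP; split => z /=; rewrite ffunE.
      exact: (fiber_measurable_comp (fun w : W => w i) meta).
    by move=> z /= ez; move: wi; rewrite -ez ffunE.
  rewrite (le_trans (partition_entropy_concentrated meta (ltW e0) eta_small))//.
  rewrite mulrAC -/W /e mulfV ?gt_eqF ?mulr_gt0//; lra.
have xi_le : partition_entropy lam (itinerary TS xi j) <=
    partition_entropy lam (itinerary TS zeta j) +
    partition_entropy lam (itinerary TS eta j).
  (* As [eta] is the exclusive or of [zeta] and the indicator of [xi], the two codes differ only at
     the index given by [xi]; the default is never reached. *)
  pose decode (u w : W) : 'I_N :=
    odflt (xi point) [pick i | (u i : bool) != w i].
  apply: (partition_entropy_join lam1 (f := itinerary TS zeta j)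
    (g := itinerary TS eta j) (h := fun (u w : {ffun 'I_j -> W}) =>
      [ffun l : 'I_j => decode (u l) (w l)])).
  - exact: (fiber_measurable_itinerary TS_lam mzeta).
  - exact: (fiber_measurable_itinerary TS_lam meta).
  move=> z; apply/ffunP => l; rewrite !ffunE /decode; set z' := iter l TS z.
  case: pickP => [i|/(_ (xi z'))]; rewrite !ffunE.
    by case: (xi z' =P i) => // _; case: (G i z'.1 _).
  by rewrite eqxx; case: (G _ z'.1 _).
have zeta_le : partition_entropy lam (itinerary TS zeta j) <=
    partition_entropy mu (itinerary T alpha j) + partition_entropy lam (gamma \o snd).
  have malphaj := fiber_measurable_itinerary (n := j) T_mu malpha.
  rewrite -(partition_entropy_precomp fst_lam malphaj).
  (* At time [l] the residue is the initial one plus [l], so one value of [gamma] serves for the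
     whole itinerary and its cost does not grow with [j]. *)
  apply: (partition_entropy_join lam1 (f := itinerary T alpha j \o fst)
    (g := gamma \o snd)
    (h := fun (u : {ffun 'I_j -> {ffun 'I_(radix k n) -> W}}) (a : 'I_(radix k n)) =>
      [ffun l : 'I_j => u l (residue_of (a + l)%N)])) => //.
    exact: (fiber_measurable_precomp measurable_fst malphaj).
  move=> z; apply/ffunP => l; apply/ffunP => i.
  rewrite !ffunE /= iter_product_map /= odometer_value_iter//.
  by rewrite modnDml.
rewrite (le_trans xi_le)// lerD//.
rewrite (le_trans (partition_entropy_itinerary_le lam1 TS_lam j meta))//.
by rewrite lerMn2r eta_le orbT.
Qed.

End product_entropy.

(** * The dichotomy according to whether every prime is a period *)

Local Open Scope ereal_scope.

Theorem proposition1 (d : measure_display) (X : measurableType d)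
    (R : realType) (mu : probability X R) (T : X -> X)
    (Xstd : standard_probability_space mu) (Terg : ergodic mu T) :
  has_odometer_factor mu T \/
  exists (k : nat -> nat) (nu : probability (odometer k) R),
    [/\ is_odometer nu,
        ergodic (mu \x nu) (product_map T (@odometer_map k)) &
        (entropy mu T < +oo ->
         entropy (mu \x nu) (product_map T (@odometer_map k)) < +oo)].
Proof.
have [cyc|] := pselect (forall p, prime p -> cyclic_factor mu T p).
  by left; exact: prime_cyclic_factors_odometer Terg cyc.
move=> /existsNP[p /not_implyP[pp ncyc]]; right.
(* The constant sequence gives the [p]-adic odometer, whose partial products are the powers [p ^ n]
   covered by [ergodic_prime_power]. *)
pose k (_ : nat) := p; have k2 n : (2 <= k n)%N by exact: prime_gt1.
have [nu unif] := @exists_uniform_values k R k2.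
have radixE n : radix k n = (p ^ n)%N by rewrite /radix prod_nat_const card_ord.
exists k, nu; split.
- exact: uniform_values_is_odometer.
- apply: product_ergodic => // n B mB; rewrite radixE.
  exact: (ergodic_prime_power Terg pp ncyc mB).
- move=> fin; apply: le_lt_trans (entropy_product_le Terg.1.1 k2 unif) _.
  by rewrite lte_add_pinfty// ltry.
Qed.
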